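(* Let $\nu$ be an offspring distribution with $\nu_1=0$ and $\nu_0>0$, let $n\ge 2$ be such that a Galton-Watson tree with offspring distribution $\nu$ has exactly $n$ leaves with positive probability, and let $\mathcal{G}^{(n)}$ be a Galton-Watson tree with offspring distribution $\nu$ conditioned to have $n$ leaves. Write $\overline{m}=2m-1$ for $m\ge 1$. Then the vertex cut-tree ${\rm cut}_{\rm HW}(\mathcal{G}^{(n)})$ is a Markov branching tree (started from a block of size $\overline{n}$) with splitting probabilities $$q_{\overline{n}}(\#{\rm blocks}=\overline{k})=\frac{k-1}{k+1}\,\nu_k\,\frac{n+1}{n-1}\,\frac{\mathbb{P}(S_{k+1}=n+1)}{\nu_0\,\mathbb{P}(S_1=n)},\qquad k\ge 2,$$ where $S_k=X_1+\cdots+X_k$ for independent Galton-Watson trees $\mathcal{G}_j$ with offspring distribution $\nu$, with $X_j=\lambda(\mathcal{G}_j)$ leaves, $j\ge 1$; and where, given that there are $\overline{k}$ blocks, the ranked block sizes are distributed like the non-increasing rearrangement of $(\overline{X}_1,\ldots,\overline{X}_{k+1})$ conditionally given $X_1+\cdots+X_{k+1}=n+1$, with an additional $k-2$ blocks of size $1$ appended.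
   Context: **Trees.** A rooted planar tree $\mathbf{t}$ has a finite vertex set $V(\mathbf{t})$, a root $\rho$, and for each vertex $v$ a totally ordered set of $k_v(\mathbf{t})$ children; an edge $w\rightarrow v$ joins a child $w$ to its parent $v$. Leaves are vertices with no children and $\lambda(\mathbf{t})$ is the number of leaves; non-leaf vertices are called branch points. Trees have $k_v\neq 1$ for all $v$. **${\rm cut}_{\rm HW}(\mathbf{t})$.** Start from the single component $V(\mathbf{t})$. A component (viewed as a tree) with $m\ge 2$ leaves is split as follows: select one of its branch points $v$ with probability $(k_v-1)/(m-1)$, where $k_v$ is its number of children, and remove the edges $w\rightarrow v$ from all children $w$ of $v$; this yields $k_v+1$ components (the component of the root of the split component, in which $v$ is now a leaf, and the $k_v$ components rooted at the children of $v$). Splits are performed independently and repeatedly until all components are singletons. The tree ${\rm cut}^\circ_{\rm HW}(\mathbf{t})$ has as vertices all components that ever exist, as root the component $V(\mathbf{t})$, and the children of a component are the components into which it is split. ${\rm cut}_{\rm HW}(\mathbf{t})$ is obtained by adding, for every split at a branch point with $k$ children, $k-2$ further singleton (leaf) children to the component that is split, so that it has $2k-1=\overline{k}$ children in total. A component with $m$ leaves is regarded as a block of size $\overline{m}=2m-1$, and the added singletons as blocks of size $1$; the sizes of the children of a block of size $\overline{m}$ then sum to $\overline{m}$. **Markov branching tree.** Let $(q_N)$ be a family of probability distributions, $q_N$ on partitions of the integer $N$ (non-increasing sequences of positive integers, the block sizes, with sum $N$), for $N\ge 2$ in the relevant set of sizes. The Markov branching tree $T_N$ with splitting probabilities $(q_N)$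 is the random (non-planar) rooted tree defined recursively: $T_1$ is a single vertex; for $N\ge 2$, choose a partition $(N_1,\ldots,N_p)$ with distribution $q_N$ and, given this, let $T_N$ consist of a root whose children are the roots of independent trees with the distributions of $T_{N_1},\ldots,T_{N_p}$. The claim is that ${\rm cut}_{\rm HW}(\mathcal{G}^{(n)})$, as a non-planar rooted tree, has the law of $T_{\overline{n}}$ for the family $(q_{\overline{m}})$ given by the stated formula (for all $m\ge 2$ with $\mathbb{P}(S_1=m)>0$). *)

(* Defs.v *)
From HB Require Import structures.
From mathcomp Require Import all_boot all_order all_algebra.
From mathcomp Require Import all_classical all_reals all_analysis.

Set Implicit Arguments.
Unset Strict Implicit.
Unset Printing Implicit Defensive.

Import Order.TTheory GRing.Theory Num.Theory.
Local Open Scope classical_set_scope.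
Local Open Scope ring_scope.

(** * Discrete laws

A law on a (countable) type is given by its mass function. All mass functions
below are nonnegative with total mass at most 1, so that [esum] is their
unconditional sum and [fine] never truncates. *)

Section DiscreteLaws.
Context {R : realType}.

Definition mean (T : choiceType) (mu f : T -> R) : R :=
  fine (\esum_(x in [set: T]) (mu x * f x)%:E).

Definition Pr (T : choiceType) (mu : T -> R) (A : set T) : R :=
  fine (\esum_(x in A) (mu x)%:E).

Definition is_law (T : choiceType) (mu : T -> R) : Prop :=
  (forall x, 0 <= mu x) /\ \esum_(x in [set: T]) (mu x)%:E = 1%E.

Definition cond (T : choiceType) (mu : T -> R) (A : set T) : T -> R :=
  fun x => \1_A x * mu x / Pr mu A.

Definition image_law (T U : choiceType) (mu : T -> R) (f : T -> U) : U -> R :=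
  fun y => Pr mu [set x | f x = y].

(** Law of [Y] when [X] has law [mu] and [Y] has law [K x] given [X = x]. *)
Definition mix (T U : choiceType) (mu : T -> R) (K : T -> U -> R) : U -> R :=
  fun y => mean mu (K^~ y).

Definition iid (T : choiceType) (mu : T -> R) (k : nat) : k.-tuple T -> R :=
  fun xs => \prod_(x <- xs) mu x.

(** Mass at [ys] of independent variables with laws [K x], [x] in [xs]. *)
Fixpoint indep_mass (A B : Type) (K : A -> B -> R) (xs : seq A) (ys : seq B)
    {struct ys} : R :=
  match xs, ys with
  | [::], [::] => 1
  | x :: xs', y :: ys' => K x y * indep_mass K xs' ys'
  | _, _ => 0
  end.

End DiscreteLaws.

(** * Rooted planar trees *)

Inductive tree := Node of seq tree.

Definition leaf : tree := Node [::].

Fixpoint tree_encode (t : tree) : GenTree.tree unit :=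
  let: Node ts := t in GenTree.Node 0 (map tree_encode ts).

Fixpoint tree_decode (u : GenTree.tree unit) : tree :=
  if u is GenTree.Node _ us then Node (map tree_decode us) else leaf.

Lemma tree_encodeK : cancel tree_encode tree_decode.
Proof.
rewrite /cancel; fix IH 1 => -[ts] /=; congr Node.
by elim: ts => //= t ts ->; rewrite IH.
Qed.

HB.instance Definition _ := Countable.copy tree (can_type tree_encodeK).

(** Equality of the underlying non-planar rooted trees. *)
Fixpoint tree_iso (t u : tree) : bool :=
  let: Node ts := t in let: Node us := u in
  has (all2 tree_iso ts) (permutations us).

(** Vertices in Ulam-Harris coding: the root is the empty word and the [i]-th
child of [v] is [rcons v i]. *)
Definition vertex := seq nat.

Fixpoint vertices (t : tree) : seq vertex :=
  let: Node ts := t in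
  [::] :: flatten [seq [seq iv.1 :: v | v <- iv.2]
                  | iv <- zip (iota 0 (size ts)) (map vertices ts)].

Definition is_child (v w : vertex) : bool :=
  prefix v w && (size w == (size v).+1).

(** A component is the list of its vertices. When a split removes an edge
[w -> v], it separates [v] from [w]; hence the edges of a component are exactly
the edges of the initial tree with both ends in the component. *)
Definition component := seq vertex.

Definition children (C : component) (v : vertex) : seq vertex :=
  [seq w <- C | is_child v w].

Definition nchildren (C : component) (v : vertex) : nat := size (children C v).

Definition nleaves (C : component) : nat :=
  count (fun v => nchildren C v == 0%N) C.

Definition branch_points (C : component) : seq vertex :=
  [seq v <- C | nchildren C v != 0%N].

Definition lambda (t : tree) : nat := nleaves (vertices t).

(** The component of the root of [C] when the edges from [v] to its children
are removed, followed by the components of these children. *)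
Definition split_at (C : component) (v : vertex) : seq component :=
  [seq x <- C | ~~ (prefix v x && (x != v))]
    :: [seq [seq x <- C | prefix w x] | w <- children C v].

Definition bar (m : nat) : nat := (2 * m - 1)%N.

(** The total order of the children in [cut_circ] (the order of [split_at]) and
in [markov_branching] (the order of the partition) is immaterial: these laws
are only used up to [tree_iso]. *)

Section RandomTrees.
Context {R : realType}.

(** Only finite trees are considered: when [nu] is supercritical the total mass
of [GW nu] is the extinction probability. As [nu 0 > 0] and [nu 1 = 0], an
infinite Galton-Watson tree has almost surely infinitely many leaves, and thus
does not contribute to the events [S_k = m]. *)
Definition GW (nu : nat -> R) (t : tree) : R :=
  \prod_(v <- vertices t) nu (nchildren (vertices t) v).

Definition GWn (nu : nat -> R) (n : nat) : tree -> R :=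
  cond (GW nu) [set t | lambda t = n].

Definition sum_leaves (k : nat) (ts : k.-tuple tree) : nat :=
  (\sum_(t <- ts) lambda t)%N.

(** [P (S_k = m)] *)
Definition PS (nu : nat -> R) (k m : nat) : R :=
  Pr (iid (GW nu) (k := k)) [set ts | sum_leaves ts = m].

(** [cut_circ C s] is the probability that the tree of all components obtained
from [C] by successive independent splits has shape [s]. *)
Fixpoint cut_circ (C : component) (s : tree) : R :=
  let: Node ss := s in
  if size C == 1%N then (ss == [::])%:R else
  \sum_(v <- branch_points C)
    ((nchildren C v)%:R - 1) / ((nleaves C)%:R - 1)
      * indep_mass cut_circ (split_at C v) ss.

(** A split at a branch point with [k] children yields [k + 1] components, and
[k - 2 = (k + 1) - 3] singletons are added. *)
Fixpoint add_singletons (s : tree) : tree :=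
  let: Node ss := s in
  Node (map add_singletons ss ++ nseq (size ss - 3) leaf).

Definition cut_HW (t : tree) : tree -> R :=
  image_law (cut_circ (vertices t)) add_singletons.

Definition is_partition (N : nat) (p : seq nat) : bool :=
  [&& sorted geq p, all (leq 1) p & sumn p == N].

(** [q N] is a law on partitions of [N], for [N >= 2] in a set of sizes which
contains the blocks of all partitions that are charged. *)
Definition splitting_probabilities (sizes : set nat)
    (q : nat -> seq nat -> R) : Prop :=
  forall N, sizes N -> (2 <= N)%N ->
    is_law (q N) /\
    (forall p, q N p != 0 -> is_partition N p /\ {in p, forall M, sizes M}).

Fixpoint markov_branching (q : nat -> seq nat -> R) (N : nat) (s : tree) : R :=
  let: Node ss := s in
  if N == 1%N then (ss == [::])%:R else
  mean (q N) (fun p => indep_mass (markov_branching q) p ss).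

Definition eq_law_nonplanar (mu mu' : tree -> R) : Prop :=
  forall s, Pr mu [set t | tree_iso t s] = Pr mu' [set t | tree_iso t s].

(** Law of the ranked block sizes given that there are [bar k] blocks, when a
block of size [bar m] is split. *)
Definition block_sizes (nu : nat -> R) (m k : nat) : seq nat -> R :=
  image_law
    (cond (iid (GW nu) (k := k.+1)) [set ts | sum_leaves ts = m.+1])
    (fun ts => sort geq [seq bar (lambda t) | t <- ts] ++ nseq (k - 2) 1%N).

End RandomTrees.

(* Main.v *)
Require Import Defs.
From HB Require Import structures.
From mathcomp Require Import all_boot all_order all_algebra.
From mathcomp Require Import zify ring.
From mathcomp Require Import all_classical all_reals all_analysis.

Set Implicit Arguments.
Unset Strict Implicit.
Unset Printing Implicit Defensive.

Import Order.TTheory GRing.Theory Num.Theory.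
Local Open Scope classical_set_scope.
Local Open Scope ring_scope.

(** Splitting a tree at a branch point [v] with [k] children produces the
component of the root, in which [v] is a leaf, and the [k] subtrees above [v].
Conversely the tree is recovered by grafting the [k] subtrees on a marked leaf
of the first component. The Galton-Watson weight is multiplicative under
grafting, up to the factor [nu k / nu 0], so that choosing a leaf of the first
of [k + 1] independent Galton-Watson trees with [m + 1] leaves in total
accounts for all trees with [m] leaves and a marked branch point. The number of
leaves of the first tree is then replaced by its average [(m + 1) / (k + 1)],
because what is computed from the components is symmetric. This gives the
splitting law, and shows that the components are conditionally independent
Galton-Watson trees given their numbers of leaves, whence the Markov branching
property by induction. Non-planar trees are handled through canonical forms,
and sums of nonnegative families in the extended reals make all exchanges and
changes of variables unconditional. *)

(** * Sums of nonnegative families *)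

Section Esum.
Local Open Scope ereal_scope.
Context {R : realType}.

Lemma le_esum_term (T : choiceType) (A : set T) (f : T -> \bar R) x :
  A x -> f x <= \esum_(y in A) f y.
Proof.
move=> Ax; apply: esum_ge; exists [set x]; last by rewrite fsbig_set1.
by split; [exact: finite_set1|move=> _ ->].
Qed.

(** For a finite positive scalar, one inequality comes from the finite subsums and the other is the
    same inequality for the inverse scalar. For an infinite scalar, both sides are 0 if [f] vanishes
    on [A], and infinite otherwise. *)
Lemma esumZl (T : choiceType) (A : set T) (c : \bar R) (f : T -> \bar R) :
  0 <= c -> (forall x, 0 <= f x) ->
  \esum_(x in A) (c * f x) = c * \esum_(x in A) f x.
Proof.
have le_fin (r : R) (g : T -> \bar R) : (0 <= r)%R ->
    (forall x, 0 <= g x) ->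
    \esum_(x in A) (r%:E * g x) <= r%:E * \esum_(x in A) g x.
  move=> r0 g0; apply: ge_ereal_sup => _ [X [finX XA] <-].
  rewrite -ge0_mule_fsumr//; apply: lee_wpmul2l; first by rewrite lee_fin.
  by apply: ereal_sup_ubound; exists X.
case: c => [r||//] + f0.
- rewrite lee_fin le_eqVlt => /predU1P[<-|r0].
    by rewrite mul0e esum1// => x _; rewrite mul0e.
  apply/le_anti; rewrite le_fin ?(ltW r0)//=.
  have -> : \esum_(x in A) (r%:E * f x) =
      r%:E * (r^-1%:E * \esum_(x in A) (r%:E * f x)).
    by rewrite muleA -EFinM divff ?mul1e// lt0r_neq0.
  apply: lee_wpmul2l; first by rewrite lee_fin ltW.
  apply: le_trans (le_fin r^-1%R _ _ _).
  + apply: le_esum => x _.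
    by rewrite muleA -EFinM mulVf ?mul1e// lt0r_neq0.
  + by rewrite invr_ge0 ltW.
  + by move=> x; rewrite mule_ge0// lee_fin ltW.
- move=> _; have [f_eq0|] := pselect (forall x, A x -> f x = 0).
    by rewrite (esum1 f_eq0) mule0 esum1// => x /f_eq0 ->; rewrite mule0.
  move=> /existsNP[x /not_implyP[Ax /eqP fx]].
  have fx0 : 0 < f x by rewrite lt_neqAle eq_sym fx f0.
  rewrite gt0_mulye; last exact: lt_le_trans (le_esum_term _ Ax).
  apply/eqP; rewrite -leye_eq; apply: le_trans (le_esum_term _ Ax).
  by rewrite gt0_mulye.
Qed.

Lemma esumZr (T : choiceType) (A : set T) (c : \bar R) (f : T -> \bar R) :
  0 <= c -> (forall x, 0 <= f x) ->
  \esum_(x in A) (f x * c) = (\esum_(x in A) f x) * c.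
Proof.
move=> c0 f0; rewrite muleC -esumZl//.
by apply: eq_esum => x _; rewrite muleC.
Qed.

Lemma eq_esum_set (T : choiceType) (A B : set T) (f : T -> \bar R) :
  A = B -> \esum_(x in A) f x = \esum_(x in B) f x.
Proof. by move=> ->. Qed.

Lemma esum_pair (T U : choiceType) (A : set (T * U)) (f : T * U -> \bar R) :
  (forall z, 0 <= f z) ->
  \esum_(z in A) f z =
  \esum_(x in [set: T]) \esum_(y in [set y | A (x, y)]) f (x, y).
Proof.
move=> f0; rewrite esum_esum//.
rewrite [RHS](_ : _ = \esum_(z in A) f z)//.
rewrite (_ : _ `*`` _ = A); last by apply/seteqP; split=> -[x y]//= [].
by apply: eq_esum => -[].
Qed.

Lemma exchange_esum (T U : choiceType) (A : set T) (B : set U)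
    (f : T -> U -> \bar R) :
  (forall x y, 0 <= f x y) ->
  \esum_(x in A) \esum_(y in B) f x y = \esum_(y in B) \esum_(x in A) f x y.
Proof.
move=> f0; rewrite !esum_esum//.
rewrite (reindex_esum (B `*`` (fun=> A)) _ (fun z => (z.2, z.1)))//.
split=> [[x y] []|[x y] [x' y'] _ _ /= [-> ->]|[x y] [Ax By]]//.
by exists (y, x).
Qed.

Lemma esum_fibers (T U : choiceType) (A : set T) (g : T -> U)
    (f : T -> \bar R) : (forall x, 0 <= f x) ->
  \esum_(x in A) f x =
  \esum_(y in [set: U]) \esum_(x in A `&` [set x | g x = y]) f x.
Proof.
move=> f0; rewrite esum_esum//=.
rewrite (reindex_esum A _ (fun x => (g x, x)))//=.
split=> [x Ax|x y _ _ [_ ->]|[y x] [_ [Ax /= <-]]]//.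
by exists x.
Qed.

Lemma esum_comp (T U : choiceType) (A : set T) (g : T -> U)
    (f : T -> \bar R) (phi : U -> \bar R) :
  (forall x, 0 <= f x) -> (forall y, 0 <= phi y) ->
  \esum_(x in A) f x * phi (g x) =
  \esum_(y in [set: U]) (\esum_(x in A `&` [set x | g x = y]) f x) * phi y.
Proof.
move=> f0 phi0; rewrite (esum_fibers _ g); last by move=> x; rewrite mule_ge0.
apply: eq_esum => y _; rewrite -esumZr//.
by apply: eq_esum => x [_ <-].
Qed.

Lemma esum_seq_cons (T : choiceType) (A : set (seq T)) (f : seq T -> \bar R) :
  (forall s, 0 <= f s) -> (A [::] -> f [::] = 0) ->
  \esum_(s in A) f s =
  \esum_(x in [set: T]) \esum_(s in [set s | A (x :: s)]) f (x :: s).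
Proof.
move=> f0 A0; pose B := [set z : T * seq T | A (z.1 :: z.2)].
rewrite -(esum_pair B (f := fun z => f (z.1 :: z.2)))//.
rewrite (esumID [set [::]])// [X in X + _]esum1 ?add0e; last first.
  by move=> s [As s0]; move: As; rewrite s0.
apply: (reindex_esum _ _ (fun z => z.1 :: z.2)); split.
- by move=> [x s] Bz; split.
- by move=> [x s] [y t] _ _ /= [-> ->].
- by move=> [|x s] [As /=]; last by exists (x, s).
Qed.

Lemma esum_uniq_seq (T : choiceType) (s : seq T) (f : T -> \bar R) :
  (forall x, 0 <= f x) -> uniq s ->
  \sum_(x <- s) f x = \esum_(x in [set` s]) f x.
Proof.
move=> f0 uniq_s; by rewrite fsbig_seq// esum_fset.
Qed.

(** The definitions use tuples, but the later changes of variables, such as rotation and grafting,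
    are carried out on plain lists. *)
Lemma esum_tuple (T : choiceType) (k : nat) (A : set (seq T))
    (f : seq T -> \bar R) :
  \esum_(s in [set s : k.-tuple T | A s]) f s =
  \esum_(s in [set s | size s = k /\ A s]) f s.
Proof.
apply: esym; apply: (reindex_esum _ _ val); split.
- by move=> s As; split; first exact: size_tuple.
- by move=> s t _ _ /val_inj.
- by move=> s [/eqP sk As]; exists (Tuple sk).
Qed.

Lemma esum_nil (T : choiceType) (A : set (seq T)) (f : seq T -> \bar R) :
  (forall s, 0 <= f s) -> (forall x s, f (x :: s) = 0) ->
  \esum_(s in A) f s = if `[< A [::] >] then f [::] else 0.
Proof.
move=> f0 f_cons; case: asboolP => A0; last first.
  by apply: esum1 => -[|x s].
rewrite (esumID [set [::]])// [X in _ + X]esum1 ?adde0; last first.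
  by move=> [|x s] [_ /= s0]//; case: s0.
rewrite (_ : _ `&` _ = [set [::]]) ?esum_set1//.
by apply/seteqP; split=> [s []|s ->].
Qed.

(* A rotation moves any entry to the front, so that [l (head x0 s)] may be
replaced by the average of [l] over the entries of [s]. *)
Lemma esum_head (T : choiceType) (x0 : T) (A : set (seq T)) (k : nat)
    (l : T -> nat) (f : seq T -> \bar R) :
  (forall s, 0 <= f s) -> (forall s, A s -> size s = k.+1) ->
  (forall s i, A s -> A (rot i s)) -> (forall s i, f (rot i s) = f s) ->
  k.+1%:R%:E * (\esum_(s in A) ((l (head x0 s))%:R%:E * f s)) =
  \esum_(s in A) ((\sum_(x <- s) l x)%N%:R%:E * f s).
Proof.
move=> f0 sizeA rotA rotf.
have rot_nth i : (i < k.+1)%N ->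
    \esum_(s in A) ((l (nth x0 s i))%:R%:E * f s) =
    \esum_(s in A) ((l (head x0 s))%:R%:E * f s).
  move=> ik; rewrite [RHS](reindex_esum A _ (rot i)).
    apply: eq_esum => s /sizeA sk; rewrite rotf -nth0 /rot nth_cat size_drop sk.
    by rewrite subn_gt0 ik nth_drop addn0.
  split=> [s|s t _ _ /rot_inj|s As]//; first exact: rotA.
  exists (rotr i s); rewrite ?rotrK//.
  by rewrite /rotr; exact: rotA.
transitivity (\sum_(i <- iota 0 k.+1)
    \esum_(s in A) ((l (nth x0 s i))%:R%:E * f s)).
  under eq_big_seq => i do rewrite mem_iota add0n => /andP[_ /rot_nth] ->.
  set c := esum _ _; have c0 : 0 <= c.
    by apply: esum_ge0 => s _; rewrite mule_ge0 ?lee_fin.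
  elim: k.+1 0%N => [m|n IH m]; first by rewrite big_nil mul0e.
  by rewrite big_cons -IH -addn1 natrD addrC EFinD ge0_muleDl ?mul1e ?lee_fin.
rewrite -esum_sum => [|s i _ _]; last by rewrite mule_ge0 ?lee_fin.
apply: eq_esum => s /sizeA sk; rewrite -ge0_sume_distrl => [|i _]//.
by rewrite sumEFin -natr_sum (big_nth x0) sk /index_iota subn0.
Qed.

Lemma eq_esum_supp (T : choiceType) (A B : set T) (f : T -> \bar R) :
  (forall x, f x <> 0 -> A x <-> B x) -> \esum_(x in A) f x = \esum_(x in B) f x.
Proof.
move=> AB; rewrite esum_mkcond [RHS]esum_mkcond; apply: eq_esum => x _.
have [->|/eqP/AB AxB] := eqVneq (f x) 0; first by rewrite !if_same.
have -> // : (x \in A) = (x \in B).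
by apply/idP/idP; rewrite !inE => /AxB.
Qed.

Lemma le_esum_subset (T : choiceType) (A B : set T) (f : T -> \bar R) :
  (forall x, 0 <= f x) -> A `<=` B ->
  \esum_(x in A) f x <= \esum_(x in B) f x.
Proof.
move=> f0 AB; rewrite esum_mkcond [leRHS]esum_mkcond; apply: le_esum => x _.
case: ifPn => [|_]; last by case: ifP.
by rewrite inE => /AB xB; rewrite mem_set.
Qed.

Lemma fineK_le1 (x : \bar R) : 0 <= x -> x <= 1 -> (fine x)%:E = x.
Proof.
by move=> x0 x1; rewrite fineK// ge0_fin_numE// (le_lt_trans x1) ?ltry.
Qed.

Lemma esum_preimage (T U : choiceType) (B : set U) (g : T -> U)
    (f : T -> \bar R) : (forall x, 0 <= f x) ->
  \esum_(x in [set x | B (g x)]) f x =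
  \esum_(y in B) \esum_(x in [set x | g x = y]) f x.
Proof.
move=> f0; rewrite (esum_fibers _ g)// [RHS]esum_mkcond.
apply: eq_esum => y _; case: ifPn => yB.
  apply: eq_esum_set; apply/seteqP; split=> x /=; first by case.
  by move=> e; rewrite inE in yB; rewrite e.
by rewrite esum1// => x /= [gxB e]; rewrite -e mem_set in yB.
Qed.

End Esum.

(** * Sums of products of kernels over lists *)

Section IndependentProducts.
Local Open Scope ereal_scope.
Context {R : realType}.

(** Extended-real counterpart of [indep_mass], for kernels that are themselves values of [esum]. *)
Fixpoint prodE (A B : Type) (K : A -> B -> \bar R) (xs : seq A) (ys : seq B)
    {struct ys} : \bar R :=
  match xs, ys with
  | [::], [::] => 1
  | x :: xs', y :: ys' => K x y * prodE K xs' ys'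
  | _, _ => 0
  end.

Lemma indep_massE (A B : Type) (K : A -> B -> R) xs ys :
  (indep_mass K xs ys)%:E = prodE (fun x y => (K x y)%:E) xs ys.
Proof. by elim: ys xs => [|y ys IH] [|x xs]//=; rewrite EFinM IH. Qed.

Lemma prodE_ge0 (A B : Type) (K : A -> B -> \bar R) xs ys :
  (forall x y, 0 <= K x y) -> 0 <= prodE K xs ys.
Proof.
by move=> K0; elim: ys xs => [|y ys IH] [|x xs]//=; rewrite mule_ge0.
Qed.

Lemma prodE_size (A B : Type) (K : A -> B -> \bar R) xs ys :
  size xs <> size ys -> prodE K xs ys = 0.
Proof.
elim: ys xs => [|y ys IH] [|x xs]//= xsys; rewrite IH ?mule0//.
by move=> e; apply: xsys; rewrite e.
Qed.

Lemma prodE_mapl (A A' B : Type) (K : A' -> B -> \bar R) (f : A -> A') xs ys :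
  prodE K (map f xs) ys = prodE (fun x => K (f x)) xs ys.
Proof. by elim: ys xs => [|y ys IH] [|x xs]//=; rewrite IH. Qed.

Lemma eq_prodE (A : eqType) (B : Type) (K K' : A -> B -> \bar R) xs ys :
  {in xs, forall x y, K x y = K' x y} -> prodE K xs ys = prodE K' xs ys.
Proof.
elim: xs ys => [|x xs IH] [|y ys]//= KK'; rewrite KK' ?mem_head// IH//.
by move=> z zxs; apply: KK'; rewrite inE zxs orbT.
Qed.

(** Once the weights of the left list are absorbed into the kernel and the two lists are exchanged,
    a sum over the left list becomes a sum over the right one. *)
Lemma prodE_flip (A B : Type) (w : A -> \bar R) (K : A -> B -> \bar R) xs ys :
  (\big[*%E/1]_(x <- xs) w x) * prodE K xs ys =
  prodE (fun y x => w x * K x y) ys xs.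
Proof.
elim: ys xs => [|y ys IH] [|x xs]/=; rewrite ?big_nil ?mul1e ?mule0//.
by rewrite big_cons -IH -!muleA; congr (_ * _); rewrite muleCA.
Qed.

Section Choice.
Context {A B : choiceType}.
Implicit Types (K : A -> B -> \bar R) (Q : set (seq B)).

Lemma esum_prodE_nil K Q :
  \esum_(ys in Q) prodE K [::] ys = if `[< Q [::] >] then 1 else 0.
Proof.
rewrite esum_nil//= => s; case: s => //=; exact: lee01.
Qed.

Lemma esum_prodE_cons K x xs Q : (forall x y, 0 <= K x y) ->
  \esum_(ys in Q) prodE K (x :: xs) ys =
  \esum_(y in [set: B])
    (K x y * \esum_(ys in [set ys | Q (y :: ys)]) prodE K xs ys).
Proof.
move=> K0; rewrite esum_seq_cons//=; last by move=> s; exact: (@prodE_ge0 _ _ K).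
by apply: eq_esum => y _; rewrite esumZl// => s; exact: prodE_ge0.
Qed.

(** Images of independent variables under [d] are independent. The maps used later are [canon],
    [canon \o add_singletons] and [lambda]. *)
Lemma esum_prodE_image (C : choiceType) (d : B -> C) K (Q : set (seq C)) xs :
  (forall x y, 0 <= K x y) ->
  \esum_(ys in [set ys | Q (map d ys)]) prodE K xs ys =
  \esum_(zs in Q)
    prodE (fun x z => \esum_(y in [set y | d y = z]) K x y) xs zs.
Proof.
move=> K0; elim: xs Q => [|x xs IH] Q.
  by rewrite esum_nil ?esum_nil//= => -[|? ?]//=; exact: lee01.
have K'0 x1 z : 0 <= \esum_(y in [set y | d y = z]) K x1 y.
  by apply: esum_ge0 => y _.
rewrite esum_prodE_cons// esum_seq_cons//=; last first.
  by move=> s; apply: (@prodE_ge0 _ _ (fun x z => \esum_(y in _) K x y)).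
under eq_esum do rewrite (IH [set zs | Q (d _ :: zs)]).
(* The remaining factor depends on [y] only through [d y], so the sum over [y] is grouped along the
   fibres of [d]. *)
pose phi z := \esum_(zs in [set zs | Q (z :: zs)])
  prodE (fun x z => \esum_(y in [set y | d y = z]) K x y) xs zs.
rewrite (esum_comp _ d (phi := phi))//; last first.
  by move=> z; apply: esum_ge0 => s _; exact: prodE_ge0.
apply: eq_esum => z _; rewrite setTI esumZl// => s; exact: prodE_ge0.
Qed.

(** As [Q] is closed under permutation, a reordering of [xs] is compensated by one of [ys]. The
    claim [front] moves one entry past a prefix by exchanging two sums. *)
Lemma esum_prodE_perm K xs xs' Q : (forall x y, 0 <= K x y) ->
  (forall ys ys', perm_eq ys ys' -> Q ys -> Q ys') -> perm_eq xs xs' ->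
  \esum_(ys in Q) prodE K xs ys = \esum_(ys in Q) prodE K xs' ys.
Proof.
move=> K0.
have front x (s1 s2 : seq A) Q' :
    (forall ys ys', perm_eq ys ys' -> Q' ys -> Q' ys') ->
    \esum_(ys in Q') prodE K (x :: s1 ++ s2) ys =
    \esum_(ys in Q') prodE K (s1 ++ x :: s2) ys.
  elim: s1 Q' => [//|x1 s1 IH] Q' permQ.
  rewrite [RHS]esum_prodE_cons//.
  under [RHS]eq_esum => y _.
    rewrite -IH; last first.
      by move=> ys ys' p; apply: permQ; rewrite perm_cons.
    rewrite esum_prodE_cons// -esumZl//; last first.
      by move=> z; rewrite mule_ge0//; apply: esum_ge0 => *; exact: prodE_ge0.
    under eq_esum do rewrite muleCA.
    over.
  rewrite exchange_esum; last first.
    move=> *; do 2![rewrite mule_ge0//].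
    by apply: esum_ge0 => *; exact: prodE_ge0.
  rewrite esum_prodE_cons//; apply: eq_esum => z _; rewrite esumZl//; last first.
    by move=> y; rewrite mule_ge0//; apply: esum_ge0 => *; exact: prodE_ge0.
  congr (_ * _); rewrite esum_prodE_cons//; apply: eq_esum => y _.
  congr (_ * _); apply: eq_esum_set; apply/seteqP.
  by split=> ys /=; apply: permQ; rewrite (perm_catCA [:: _] [:: _]).
elim: xs xs' Q => [|x xs IH] xs' Q permQ.
  by rewrite perm_sym => /perm_nilP ->.
move=> pxs; have xxs' : x \in xs' by rewrite -(perm_mem pxs) mem_head.
case/splitPr: xxs' pxs => s1 s2.
rewrite perm_sym (perm_catCA s1 [:: x]) perm_cons perm_sym => pxs.
rewrite -front// !esum_prodE_cons//; apply: eq_esum => y _.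
congr (_ * _); apply: IH => // ys ys' p.
by apply: permQ; rewrite perm_cons.
Qed.

Lemma esum_delta (y0 : B) (phi : B -> \bar R) : (forall y, 0 <= phi y) ->
  \esum_(y in [set: B]) ((if y == y0 then 1 else 0) * phi y) = phi y0.
Proof.
move=> phi0; rewrite (esumID [set y0]); last first.
  by move=> y _; case: ifP; rewrite ?mul1e ?mul0e.
rewrite setTI esum_set1 eqxx mul1e// esum1 ?adde0// => y [_ /= /eqP/negPf ->].
by rewrite mul0e.
Qed.

(** Entries with index [z] take the value [y0] almost surely. This handles the added singletons: a
    block of size 1 always gives [leaf]. *)
Lemma esum_prodE_cat_nseq K (z : A) (y0 : B) xs r Q :
  (forall x y, 0 <= K x y) -> (forall y, K z y = if y == y0 then 1 else 0) ->
  \esum_(ys in Q) prodE K (xs ++ nseq r z) ys =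
  \esum_(ys in [set ys | Q (ys ++ nseq r y0)]) prodE K xs ys.
Proof.
move=> K0 Kz; have S0 xs' (Q' : set (seq B)) :
  0 <= \esum_(ys in Q') prodE K xs' ys by apply: esum_ge0 => *; exact: prodE_ge0.
elim: xs Q => [|x xs IH] Q /=.
  elim: r Q => [|r IH] Q /=; first by rewrite !esum_prodE_nil.
  rewrite esum_prodE_cons//; under eq_esum do rewrite Kz.
  by rewrite esum_delta// IH !esum_prodE_nil.
rewrite !esum_prodE_cons//; apply: eq_esum => y _; congr (_ * _).
exact: IH.
Qed.

End Choice.

Lemma esum_prod_le1 (T : choiceType) (w : T -> \bar R) (P : pred T) (k : nat) :
  (forall x, 0 <= w x) -> \esum_(x in [set x | P x]) w x <= 1 ->
  \esum_(s in [set s | size s = k /\ all P s])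
    (\big[*%E/1]_(x <- s) w x) <= 1.
Proof.
move=> w0 w1; have W0 s : 0 <= \big[*%E/1]_(x <- s) w x.
  by elim/big_ind: _ => // *; exact: mule_ge0.
elim: k => [|k IH].
  rewrite (_ : [set _ | _] = [set [::]]) ?esum_set1 ?big_nil//.
  by apply/seteqP; split=> s /=; [move=> [/size0nil]|move=> ->].
rewrite esum_seq_cons//; last by case.
apply: le_trans w1; rewrite [leRHS]esum_mkcond; apply: le_esum => x _.
have -> : \esum_(s in [set s | size (x :: s) = k.+1 /\ all P (x :: s)])
    (\big[*%E/1]_(y <- x :: s) w y) =
  w x * \esum_(s in [set s | size (x :: s) = k.+1 /\ all P (x :: s)])
    (\big[*%E/1]_(y <- s) w y).
  by rewrite -esumZl//; apply: eq_esum => s _; rewrite big_cons.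
case: ifPn => [Px|/negP Px]; last first.
  rewrite esum1 ?mule0// => s /= [_ /andP[Px' _]].
  by case: Px; rewrite inE.
rewrite -[leRHS]mule1 lee_wpmul2l//; apply: le_trans IH.
rewrite (@eq_esum_set _ _ _ [set s | size s = k /\ all P s])//.
apply/seteqP; split=> s /=; first by move=> [[->] /andP[]].
by move=> [-> ->]; rewrite andbT; move: Px; rewrite inE.
Qed.

End IndependentProducts.

(** * Trees, grafting and components *)

Lemma tree_seq_ind (P : tree -> Prop) :
  (forall ts : seq tree, {in ts, forall t, P t} -> P (Node ts)) -> forall t, P t.
Proof.
move=> IH; fix rec 1 => -[ts]; apply: IH.
elim: ts => [u|t ts IHts u]; first by rewrite in_nil; clear rec.
rewrite inE => /orP[/eqP -> //|/IHts].
exact.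
Qed.

Definition kids (t : tree) : seq tree := let: Node ts := t in ts.

Fixpoint subtree (t : tree) (v : vertex) : tree :=
  if v is i :: v' then subtree (nth leaf (kids t) i) v' else t.

(** With [ts] empty this is the component of the root after the split at [v]; with the subtrees cut
    off by the split, it undoes the split. *)
Fixpoint graft (t : tree) (v : vertex) (ts : seq tree) : tree :=
  if v is i :: v' then
    Node (set_nth leaf (kids t) i (graft (nth leaf (kids t) i) v' ts))
  else Node ts.

Lemma verticesE ts :
  vertices (Node ts) =
  [::] :: [seq i :: v | i <- iota 0 (size ts), v <- vertices (nth leaf ts i)].
Proof.
rewrite /=; congr (_ :: flatten _).
rewrite -[X in map vertices X](mkseq_nth leaf) /mkseq -map_comp.
by rewrite -[X in zip X _]map_id zip_map -map_comp.
Qed.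

Local Arguments vertices : simpl never.

Lemma nil_vertices t : [::] \in vertices t.
Proof. by case: t => ts; rewrite verticesE mem_head. Qed.

Lemma cons_vertices i v t :
  (i :: v \in vertices t) =
  (i < size (kids t))%N && (v \in vertices (nth leaf (kids t) i)).
Proof.
case: t => ts; rewrite verticesE inE /=; apply/allpairsPdep/andP.
  by move=> [j [w [+ wj [-> ->]]]]; rewrite mem_iota.
by move=> [its vi]; exists i, v; rewrite mem_iota.
Qed.

Lemma uniq_vertices t : uniq (vertices t).
Proof.
elim/tree_seq_ind: t => ts IH; rewrite verticesE cons_uniq; apply/andP; split.
  by apply/negP => /allpairsPdep[i [v []]].
apply: allpairs_uniq_dep; first exact: iota_uniq.
  by move=> i; rewrite mem_iota => its; apply: IH; rewrite mem_nth.
by move=> [i v] [j w] _ _ /= [-> ->].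
Qed.

Lemma big_vertices (S : Type) (idx : S) (op : Monoid.law idx) ts
    (f : vertex -> S) :
  \big[op/idx]_(v <- vertices (Node ts)) f v =
  op (f [::]) (\big[op/idx]_(i <- iota 0 (size ts))
    \big[op/idx]_(v <- vertices (nth leaf ts i)) f (i :: v)).
Proof. by rewrite verticesE big_cons big_allpairs_dep. Qed.

Lemma filter_vertices (p : pred vertex) ts :
  [seq v <- vertices (Node ts) | p v] =
  (if p [::] then [:: [::]] else [::]) ++
  flatten [seq [seq i :: v | v <- vertices (nth leaf ts i) & p (i :: v)]
          | i <- iota 0 (size ts)].
Proof.
rewrite verticesE /= filter_flatten -map_comp.
under eq_map do rewrite /= filter_map.
by case: (p [::]).
Qed.

Lemma flatten_map_nil (T U : eqType) (f : T -> seq U) s :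
  {in s, forall x, f x = [::]} -> flatten (map f s) = [::].
Proof.
elim: s => //= x s IH fs; rewrite fs ?mem_head// IH// => y ys.
by apply: fs; rewrite inE ys orbT.
Qed.

(** Among the branches at the root, only the one of index [i] contains descendants of a vertex
    [i :: v]. *)
Lemma flatten_iota1 (U : eqType) (f : nat -> seq U) i n : (i < n)%N ->
  (forall j, j != i -> f j = [::]) -> flatten (map f (iota 0 n)) = f i.
Proof.
move=> ltin fi; rewrite -[n](subnKC ltin) iotaD map_cat flatten_cat.
rewrite -addn1 iotaD map_cat flatten_cat /= !flatten_map_nil ?cats0//.
  move=> j; rewrite mem_iota add0n => /andP[].
  by rewrite addn1 => ij _; rewrite fi// gtn_eqF.
by move=> j; rewrite mem_iota add0n => /andP[_ ji]; rewrite fi// ltn_eqF.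
Qed.

Lemma childrenE t v : v \in vertices t ->
  children (vertices t) v =
  [seq rcons v i | i <- iota 0 (size (kids (subtree t v)))].
Proof.
rewrite /children; elim: v t => [|i v IH] [ts]; rewrite filter_vertices.
  move=> _ /=; rewrite -(flatten_map1 (rcons [::])); congr flatten.
  apply: eq_map => i /=.
  rewrite (@eq_filter _ _ (pred1 [::])); last by case.
  by rewrite filter_pred1_uniq ?uniq_vertices ?nil_vertices.
rewrite cons_vertices => /andP[/= its vi].
rewrite (flatten_iota1 its) => [|j ji]; last first.
  rewrite (@eq_filter _ _ pred0) ?filter_pred0// => w.
  by rewrite /is_child /= eq_sym (negPf ji).
rewrite (@eq_filter _ _ (is_child v)) => [|w]; last first.
  by rewrite /is_child /= eqxx eqSS.
by rewrite IH// -map_comp.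
Qed.

Lemma nchildrenE t v : v \in vertices t ->
  nchildren (vertices t) v = size (kids (subtree t v)).
Proof. by move=> vt; rewrite /nchildren childrenE// size_map size_iota. Qed.

Lemma filter_prefix t w : w \in vertices t ->
  [seq x <- vertices t | prefix w x] = map (cat w) (vertices (subtree t w)).
Proof.
elim: w t => [|i w IH] [ts].
  move=> _; rewrite (@eq_filter _ _ predT) ?filter_predT ?map_id//.
  by move=> x; rewrite prefix0s.
rewrite cons_vertices filter_vertices => /andP[/= its wi].
rewrite (flatten_iota1 its) => [|j ji]; last first.
  by rewrite (@eq_filter _ _ pred0) ?filter_pred0// => x; rewrite /= eq_sym (negPf ji).
rewrite (@eq_filter _ _ (prefix w)) => [|x]; last by rewrite /= eqxx.
by rewrite IH// -map_comp.
Qed.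

Lemma filter_prune t v : v \in vertices t ->
  [seq x <- vertices t | ~~ (prefix v x && (x != v))] = vertices (graft t v [::]).
Proof.
elim: v t => [|i v IH] [ts]; rewrite filter_vertices.
  move=> _; rewrite [graft _ _ _]/= verticesE /= flatten_map_nil// => i _.
  by rewrite (@eq_filter _ _ pred0) ?filter_pred0.
rewrite cons_vertices => /andP[/= its vi].
rewrite [graft _ _ _]/= verticesE size_set_nth (maxn_idPr its) /=.
congr (_ :: flatten _); apply: eq_map => j; rewrite nth_set_nth /= eq_sym; case: eqVneq => [->|ij].
  rewrite -IH//; congr map; apply: eq_filter => x.
  by rewrite eqseq_cons !eqxx.
rewrite (@eq_filter _ _ predT) ?filter_predT// => x; by rewrite (negPf ij).
Qed.

Lemma branch_pointsE t :
  branch_points (vertices t) =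
  [seq v <- vertices t | kids (subtree t v) != [::]].
Proof.
by apply: eq_in_filter => v vt; rewrite nchildrenE// size_eq0.
Qed.

(** The components above [v] keep their addresses in [t], hence the common prefix [rcons v i];
    [cut_circ_cat] shows that it does not affect the cut-tree. *)
Lemma split_atE t v : v \in vertices t ->
  split_at (vertices t) v =
  vertices (graft t v [::]) ::
  [seq map (cat (rcons v i)) (vertices (nth leaf (kids (subtree t v)) i))
  | i <- iota 0 (size (kids (subtree t v)))].
Proof.
move=> vt; rewrite /split_at filter_prune// childrenE// -map_comp; congr cons.
apply/eq_in_map => i; rewrite mem_iota add0n /= => ik.
have [vit ->] : rcons v i \in vertices t /\
    nth leaf (kids (subtree t v)) i = subtree t (rcons v i).
  elim: v t vt ik => [|j v IH] [ts]; first by rewrite cons_vertices nil_vertices => _ ->.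
  rewrite !cons_vertices => /andP[/= jts vj] /IH-/(_ vj)[-> ->].
  by rewrite jts.
exact: filter_prefix.
Qed.

Lemma set_nth_nth (T : Type) (x0 : T) (s : seq T) i : (i < size s)%N ->
  set_nth x0 s i (nth x0 s i) = s.
Proof. by elim: s i => [//|x s IH] [|i] //= /IH ->. Qed.

(** The same [z] serves all replacements [u], so two of them can be compared without knowing the
    other entries. *)
Lemma big_set_nth (S T : Type) (idx : S) (op : Monoid.com_law idx)
    (x0 : T) (s : seq T) i (f : T -> S) : (i < size s)%N ->
  exists z, forall u, \big[op/idx]_(x <- set_nth x0 s i u) f x = op z (f u).
Proof.
elim: s i => [//|x s IH] [|i] /= => [_|/IH[z e]].
  by exists (\big[op/idx]_(y <- s) f y) => u; rewrite big_cons Monoid.mulmC.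
by exists (op (f x) z) => u; rewrite big_cons e Monoid.mulmA.
Qed.

Lemma lambdaE ts :
  lambda (Node ts) = if ts == [::] then 1%N else (\sum_(t <- ts) lambda t)%N.
Proof.
have lamE t : lambda t =
    (\sum_(v <- vertices t) (kids (subtree t v) == [::]))%N.
  rewrite /lambda /nleaves -sum1_count big_mkcond; apply: eq_big_seq => v vt.
  by rewrite nchildrenE// size_eq0; case: eqP.
rewrite lamE big_vertices /=; case: eqP => [->|_]; first by rewrite big_nil.
rewrite add0n [RHS](big_nth leaf) /index_iota subn0.
by apply: eq_bigr => i _; rewrite lamE.
Qed.

Lemma lambda_gt0 t : (0 < lambda t)%N.
Proof.
elim/tree_seq_ind: t => ts IH; rewrite lambdaE; case: eqP => //.
case: ts IH => // t ts IH _; rewrite big_cons.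
by rewrite (leq_trans (IH t _)) ?mem_head ?leq_addr.
Qed.

(** A balance without subtraction, by induction along the path [v]; the subtree at [v] is exchanged
    for [Node ts]. *)
Lemma lambda_graft t v ts : v \in vertices t ->
  (lambda (graft t v ts) + lambda (subtree t v) = lambda t + lambda (Node ts))%N.
Proof.
elim: v t => [|i v IH] [us]; first by rewrite addnC.
rewrite cons_vertices => /andP[/= ius vi].
have := IH _ vi; rewrite !lambdaE.
have -> : (us == [::]) = false by case: us ius {IH vi}.
have -> : (set_nth leaf us i (graft (nth leaf us i) v ts) == [::]) = false.
  by rewrite -size_eq0 size_set_nth; case: (us) ius => //= *; rewrite /maxn; case: ifP.
have [z e] := @big_set_nth _ _ 0%N addn leaf us i lambda ius.
have := e (nth leaf us i); rewrite set_nth_nth// e => -> /=.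
case: eqP => _ IHv; lia.
Qed.

Lemma subtree_graft t v ts : subtree (graft t v ts) v = Node ts.
Proof. by elim: v t => [//|i v IH] t /=; rewrite nth_set_nth /= eqxx IH. Qed.

Lemma graft_vertices t v ts : v \in vertices t -> v \in vertices (graft t v ts).
Proof.
elim: v t => [|i v IH] t; first by rewrite nil_vertices.
rewrite !cons_vertices => /andP[its vi] /=; rewrite nth_set_nth /= eqxx IH//.
by rewrite size_set_nth (maxn_idPr its) its.
Qed.

Lemma graft_graft t v us ts : graft (graft t v us) v ts = graft t v ts.
Proof.
by elim: v t => [//|i v IH] t /=; rewrite nth_set_nth /= eqxx IH set_set_nth eqxx.
Qed.

Lemma graft_kids t v : v \in vertices t -> graft t v (kids (subtree t v)) = t.
Proof.
elim: v t => [|i v IH] [ts]//.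
rewrite cons_vertices => /andP[/= its vi]; rewrite IH//; congr Node.
apply: (@eq_from_nth _ leaf); rewrite size_set_nth (maxn_idPr its)// => j _.
by rewrite nth_set_nth /=; case: eqP => // ->.
Qed.

(** * Weights of grafted trees and the count of branch points *)

Section Weights.
Context {R : realType}.
Variable nu : nat -> R.

Lemma GW_Node ts : GW nu (Node ts) = nu (size ts) * \prod_(t <- ts) GW nu t.
Proof.
have GWE t : GW nu t = \prod_(v <- vertices t) nu (size (kids (subtree t v))).
  by apply: eq_big_seq => v vt; rewrite nchildrenE.
rewrite GWE big_vertices /=; congr (_ * _).
rewrite [RHS](big_nth leaf) /index_iota subn0.
by apply: eq_bigr => i _; rewrite GWE.
Qed.

(** The balance is written without division, so that it also covers trees of weight 0. *)
Lemma GW_graft t v ts : v \in vertices t ->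
  GW nu (graft t v ts) * GW nu (subtree t v) = GW nu t * GW nu (Node ts).
Proof.
elim: v t => [|i v IH] [us]; first by rewrite mulrC.
rewrite cons_vertices => /andP[/= ius vi]; rewrite [GW nu (Node us)]GW_Node.
rewrite [GW nu (Node (set_nth _ _ _ _))]GW_Node size_set_nth (maxn_idPr ius).
have [z e] := @big_set_nth _ _ 1 *%R leaf us i (GW nu) ius.
have := e (nth leaf us i); rewrite set_nth_nth// e => ->.
by rewrite -!mulrA IH//; ring.
Qed.

(* A tree has one vertex more than it has edges. *)
Lemma sum_nchildren_sub1 t :
  \sum_(v <- vertices t) ((size (kids (subtree t v)))%:R - 1) = -1 :> R.
Proof.
elim/tree_seq_ind: t => ts IH; rewrite big_vertices /=.
rewrite (eq_big_seq (fun=> -1)) => [|i]; last first.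
  by rewrite mem_iota add0n => /andP[_ its]; rewrite IH// mem_nth.
rewrite big_const_seq count_predT size_iota iter_addr addr0 mulNrn.
by rewrite addrAC subrr add0r.
Qed.

(** Each leaf contributes -1 to the sum over all vertices, which is -1. Hence the selection
    probabilities of the branch points add up to 1. *)
Lemma sum_branch_points t :
  \sum_(v <- vertices t | kids (subtree t v) != [::])
    ((size (kids (subtree t v)))%:R - 1) = (lambda t)%:R - 1 :> R.
Proof.
have := sum_nchildren_sub1 t; rewrite (bigID (fun v => kids (subtree t v) == [::])) /=.
rewrite (eq_bigr (fun=> -1)) => [|v /eqP ->]; last by rewrite sub0r.
rewrite big_const_seq iter_addr addr0 => /(canRL (addKr _)) ->.
rewrite mulNrn opprK; congr (_%:R - 1); rewrite /lambda /nleaves.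
by apply: eq_in_count => v vt /=; rewrite nchildrenE// size_eq0.
Qed.

End Weights.

(** * The recursion of the cut-tree *)

Section CutRecursion.
Context {R : realType}.
Implicit Types (C : component) (v w : vertex).

Lemma indep_mass_mapl (A A' B : Type) (K : A' -> B -> R) (f : A -> A') xs ys :
  indep_mass K (map f xs) ys = indep_mass (fun x => K (f x)) xs ys.
Proof. by elim: ys xs => [|y ys IH] [|x xs]//=; rewrite IH. Qed.

Lemma eq_indep_mass (A : Type) (B : eqType) (K K' : A -> B -> R) xs ys :
  {in ys, forall y x, K x y = K' x y} -> indep_mass K xs ys = indep_mass K' xs ys.
Proof.
elim: ys xs => [|y ys IH] [|x xs]//= KK'; rewrite KK' ?mem_head// IH//.
by move=> z zys; apply: KK'; rewrite inE zys orbT.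
Qed.

Lemma indep_mass_ge0 (A B : Type) (K : A -> B -> R) xs ys :
  (forall x y, 0 <= K x y) -> 0 <= indep_mass K xs ys.
Proof.
by move=> K0; elim: ys xs => [|y ys IH] [|x xs]//=; rewrite mulr_ge0.
Qed.

Lemma indep_mass_le1 (A : Type) (B : eqType) (K : A -> B -> R) xs ys :
  {in ys, forall y x, 0 <= K x y <= 1} -> 0 <= indep_mass K xs ys <= 1.
Proof.
elim: ys xs => [|y ys IH] [|x xs] //= K01; rewrite ?lexx ?ler01//.
have /andP[y0 y1] := K01 y (mem_head _ _) x.
have /andP[i0 i1] : 0 <= indep_mass K xs ys <= 1.
  by apply: IH => z zys; apply: K01; rewrite inE zys orbT.
by rewrite mulr_ge0// mulr_ile1.
Qed.

Lemma is_child_cat w v x : is_child (w ++ v) (w ++ x) = is_child v x.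
Proof. by rewrite /is_child prefix_catr// eqxx !size_cat -addnS eqn_add2l. Qed.

Lemma children_cat w C v :
  children (map (cat w) C) (w ++ v) = map (cat w) (children C v).
Proof.
rewrite /children filter_map; congr map; apply: eq_filter => x /=.
exact: is_child_cat.
Qed.

Lemma nchildren_cat w C v :
  nchildren (map (cat w) C) (w ++ v) = nchildren C v.
Proof. by rewrite /nchildren children_cat size_map. Qed.

Lemma nleaves_cat w C : nleaves (map (cat w) C) = nleaves C.
Proof.
by rewrite /nleaves count_map; apply: eq_count => v /=; rewrite nchildren_cat.
Qed.

Lemma branch_points_cat w C :
  branch_points (map (cat w) C) = map (cat w) (branch_points C).
Proof.
rewrite /branch_points filter_map; congr map; apply: eq_filter => v /=.
by rewrite nchildren_cat.
Qed.

Lemma split_at_cat w C v :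
  split_at (map (cat w) C) (w ++ v) = map (map (cat w)) (split_at C v).
Proof.
rewrite /split_at children_cat /= -!map_comp filter_map; congr cons.
  congr map; apply: eq_filter => x /=.
  by rewrite prefix_catr// eqxx eqseq_cat// eqxx.
apply: eq_map => x /=; rewrite filter_map; congr map; apply: eq_filter => y /=.
by rewrite prefix_catr// eqxx.
Qed.

Lemma cut_circE C ss :
  cut_circ C (Node ss) =
  (if size C == 1%N then (ss == [::])%:R else
   \sum_(v <- branch_points C)
     ((nchildren C v)%:R - 1) / ((nleaves C)%:R - 1) *
     indep_mass cut_circ (split_at C v) ss) :> R.
Proof. by case: C. Qed.

(** Children, leaves and splits are all compatible with a common prefix, so a subtree may be treated
    as a tree in its own right. *)
Lemma cut_circ_cat w C s : cut_circ (map (cat w) C) s = cut_circ C s :> R.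
Proof.
elim/tree_seq_ind: s C => ss IH C; rewrite !cut_circE size_map; case: ifP => // _.
rewrite branch_points_cat big_map; apply: eq_bigr => v _.
rewrite nchildren_cat nleaves_cat split_at_cat; congr (_ * _).
rewrite indep_mass_mapl; apply: eq_indep_mass => s sss x; exact: IH.
Qed.

(** Up to a common prefix, the components are vertex lists of trees, so the recursion closes on
    trees. *)
Lemma cut_circ_vertices t ss :
  cut_circ (vertices t) (Node ss) =
  (if kids t == [::] then (ss == [::])%:R else
  \sum_(v <- vertices t | kids (subtree t v) != [::])
    ((size (kids (subtree t v)))%:R - 1) / ((lambda t)%:R - 1) *
    indep_mass (fun u => cut_circ (vertices u))
      (graft t v [::] :: kids (subtree t v)) ss) :> R.
Proof.
rewrite cut_circE; have -> : (size (vertices t) == 1%N) = (kids t == [::]).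
  by case: t => -[|[us] ts]; rewrite verticesE //= verticesE.
case: ifP => // _; rewrite branch_pointsE big_filter.
rewrite big_seq_cond [RHS]big_seq_cond; apply: eq_bigr => v /andP[vt _].
rewrite nchildrenE// split_atE//; congr (_ * _).
case: ss => //= s ss; congr (_ * _).
rewrite indep_mass_mapl -[kids _ in RHS](mkseq_nth leaf) /mkseq indep_mass_mapl.
by apply: eq_indep_mass => u _ i; rewrite cut_circ_cat.
Qed.

Lemma cut_circ_ge0_le1 t s : 0 <= (cut_circ (vertices t) s : R) <= 1.
Proof.
elim/tree_seq_ind: s t => ss IH t; rewrite cut_circ_vertices.
case: ifP => [_|]; first by case: eqP; rewrite ?lexx ?ler01.
move=> t0; have lam0 : 0 <= (lambda t)%:R - 1 :> R.
  by rewrite subr_ge0 ler1n lambda_gt0.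
have k0 u : kids u != [::] -> 0 <= (size (kids u))%:R - 1 :> R.
  by case: u => -[|? us]//= _; rewrite subr_ge0 ler1n.
have ind u us :
  0 <= (indep_mass (fun u => cut_circ (vertices u)) (u :: us) ss : R) <= 1.
  by apply: indep_mass_le1 => s sss x; exact: IH.
apply/andP; split.
  apply: sumr_ge0 => v kv; rewrite mulr_ge0 ?divr_ge0 ?k0//.
  by have /andP[] := ind (graft t v [::]) (kids (subtree t v)).
(* A chain of unary vertices has one leaf; as the inverse of 0 is 0, all coefficients vanish in that
   case. *)
have [lam1|lam1] := eqVneq ((lambda t)%:R - 1 : R) 0.
  by rewrite big1 ?ler01// => v _; rewrite lam1 invr0 mulr0 mul0r.
apply: (@le_trans _ _ (((lambda t)%:R - 1) / ((lambda t)%:R - 1))); last first.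
  by rewrite divff.
rewrite -[X in _ <= X / _]sum_branch_points mulr_suml; apply: ler_sum => v kv.
rewrite ler_piMr ?divr_ge0 ?k0//.
by have /andP[] := ind (graft t v [::]) (kids (subtree t v)).
Qed.

End CutRecursion.

(** * Canonical forms of non-planar trees and padding by singletons *)

Definition tree_le : rel tree := fun t u => (pickle t <= pickle u)%N.

Lemma tree_le_total : total tree_le.
Proof. by move=> t u; exact: leq_total. Qed.

Lemma tree_le_trans : transitive tree_le.
Proof. by move=> t u v; exact: leq_trans. Qed.

Lemma tree_le_anti : antisymmetric tree_le.
Proof. by move=> t u /anti_leq/(pcan_inj pickleK). Qed.

(** Sorting recursively for the arbitrary total order [tree_le] selects one representative of each
    class of [tree_iso]. *)
Fixpoint canon (t : tree) : tree :=
  let: Node ts := t in Node (sort tree_le (map canon ts)).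

Lemma sort_tree_le (ts us : seq tree) :
  (sort tree_le ts == sort tree_le us) = perm_eq ts us.
Proof.
apply/eqP/idP => /(perm_sortP tree_le_total tree_le_trans tree_le_anti)//.
Qed.

Lemma tree_iso_canon t u : tree_iso t u = (canon t == canon u).
Proof.
elim/tree_seq_ind: t u => ts IH [us] /=.
have -> : (Node (sort tree_le (map canon ts)) ==
           Node (sort tree_le (map canon us))) =
          perm_eq (map canon ts) (map canon us).
  rewrite -sort_tree_le; apply/eqP/eqP => [[]//|->//].
have all2E vs : all2 tree_iso ts vs = (map canon ts == map canon vs).
  elim: ts vs IH => [|t ts IHts] [|v vs]//= IH; rewrite eqseq_cons.
  rewrite IH ?mem_head// IHts// => x xts.
  by apply: IH; rewrite inE xts orbT.
apply/hasP/idP => [[vs]|].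
  by rewrite mem_permutations all2E => /perm_map-/(_ _ canon) + /eqP ->.
(* A permutation of the canonical forms is encoded by a list of indices, and the same indices
   permute [us]. *)
move=> /(perm_iotaP (canon leaf))[Is]; rewrite size_map => pIs def_ts.
exists [seq nth leaf us i | i <- Is].
  by rewrite mem_permutations; apply/(perm_iotaP leaf); exists Is.
rewrite all2E def_ts -map_comp; apply/eqP/eq_in_map => i.
by rewrite (perm_mem pIs) mem_iota add0n => /andP[_ ius]; rewrite /= (nth_map leaf).
Qed.

(** The padded number of children [n + (n - 3)] is strictly increasing in [n], so the original
    children form a prefix of known length. *)
Lemma add_singletons_inj : injective add_singletons.
Proof.
elim/tree_seq_ind => ts IH [us] /= [] e; congr Node.
have sz : size ts = size us.
  have := congr1 size e; rewrite !size_cat !size_map !size_nseq. lia.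
have : map add_singletons ts = map add_singletons us.
  have := congr1 (take (size ts)) e; rewrite {2}sz.
  by rewrite !take_size_cat ?size_map.
elim: ts us {e sz} IH => [|t ts IHts] [|u us]//= IH [tu tsus].
rewrite (IH t (mem_head _ _) u tu) (IHts us)// => x xts y.
by apply: IH; rewrite inE xts orbT.
Qed.

(** * Galton-Watson weights *)

Lemma esum_Node (R : realType) (A : set tree) (f : tree -> \bar R) :
  (\esum_(t in A) f t = \esum_(ts in [set ts | A (Node ts)]) f (Node ts))%E.
Proof.
by apply: (reindex_esum _ _ Node); split=> [ts|ts us _ _ []|[ts] At]//; exists ts.
Qed.

Fixpoint height (t : tree) : nat :=
  let: Node ts := t in (foldr maxn 0 (map height ts)).+1.

Lemma height_Node ts h :
  (height (Node ts) <= h.+1)%N = all (fun t => height t <= h)%N ts.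
Proof.
rewrite /= ltnS; elim: ts => //= t ts <-; exact: geq_max.
Qed.

Section GaltonWatson.
Context {R : realType}.
Variable nu : nat -> R.
Hypothesis nu_law : is_law nu.

Let nu_ge0 k : 0 <= nu k. Proof. by case: nu_law. Qed.

Lemma GW_ge0 t : 0 <= GW nu t.
Proof. by apply: prodr_ge0 => v _. Qed.

Lemma prod_GW_ge0 ts : 0 <= \prod_(t <- ts) GW nu t.
Proof. by apply: prodr_ge0 => t _; exact: GW_ge0. Qed.

Local Open Scope ereal_scope.

Lemma prod_GWE ts :
  (\prod_(t <- ts) GW nu t)%R%:E = \big[*%E/1]_(t <- ts) (GW nu t)%:E.
Proof.
elim: ts => [|t ts IH]; first by rewrite !big_nil.
by rewrite !big_cons EFinM IH.
Qed.

(** By induction on [h]: lists of [k] trees of height at most [h] have total mass at most 1, so the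
    trees one level higher with [k] children at the root have mass at most [nu k]. *)
Lemma GW_height_le1 h :
  \esum_(t in [set t | (height t <= h)%N]) (GW nu t)%:E <= 1.
Proof.
elim: h => [|h IH]; first by rewrite esum1// => -[ts].
rewrite esum_Node (esum_fibers _ size); last first.
  by move=> ts; rewrite lee_fin GW_ge0.
case: nu_law => _ <-; apply: le_esum => k _.
under eq_esum do rewrite GW_Node EFinM.
rewrite (@eq_esum _ _ _ _ (fun ts =>
  (nu k)%:E * (\prod_(t <- ts) GW nu t)%:E)); last first.
  by move=> ts [_ /= <-].
rewrite esumZl ?lee_fin//; last by move=> ts; rewrite lee_fin prod_GW_ge0.
rewrite -[leRHS]mule1 lee_wpmul2l ?lee_fin//.
apply: le_trans (esum_prod_le1 (P := fun t => height t <= h)%N k _ IH); last first.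
  by move=> t; rewrite lee_fin GW_ge0.
under eq_esum do rewrite prod_GWE.
apply: le_esum_subset => [ts|ts []]; first by rewrite -prod_GWE lee_fin prod_GW_ge0.
by rewrite /= -/(height (Node ts)) height_Node => ? ?.
Qed.

(** A finite set of trees has bounded height, so each finite subsum is controlled by
    [GW_height_le1]. *)
Lemma GW_le1 : \esum_(t in [set: tree]) (GW nu t)%:E <= 1.
Proof.
apply: ge_ereal_sup => _ [X [finX _] <-].
rewrite -esum_fset//; last by move=> t _; rewrite lee_fin GW_ge0.
have /finite_seqP[s Xs] := finX.
apply: le_trans (GW_height_le1 (\max_(t <- s) height t)).
apply: le_esum_subset => [t|t]; first by rewrite lee_fin GW_ge0.
by rewrite Xs /= => ts; exact: leq_bigmax_seq.
Qed.

Lemma esum_GW_fine (A : set tree) :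
  (Pr (GW nu) A)%:E = \esum_(t in A) (GW nu t)%:E.
Proof.
apply: fineK_le1; first by apply: esum_ge0 => t _; rewrite lee_fin GW_ge0.
apply: le_trans GW_le1; apply: le_esum_subset => // t.
by rewrite lee_fin GW_ge0.
Qed.

Lemma iid_le1 (k : nat) (A : set (seq tree)) :
  \esum_(ts in [set ts | size ts = k /\ A ts])
    (\prod_(t <- ts) GW nu t)%R%:E <= 1.
Proof.
have w0 t : 0 <= (GW nu t)%:E by rewrite lee_fin GW_ge0.
have w1 : \esum_(t in [set t | predT t]) (GW nu t)%:E <= 1.
  by apply: le_trans GW_le1; exact: le_esum_subset.
apply: le_trans (esum_prod_le1 k w0 w1).
under eq_esum do rewrite prod_GWE.
apply: le_esum_subset => [ts|ts [? _]]; last by rewrite /= all_predT.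
by rewrite -prod_GWE lee_fin prod_GW_ge0.
Qed.

Lemma Pr_iidE (k : nat) (A : set (seq tree)) :
  (Pr (iid (GW nu) (k := k)) [set ts | A ts])%:E =
  \esum_(ts in [set ts | size ts = k /\ A ts])
    (\prod_(t <- ts) GW nu t)%R%:E.
Proof.
rewrite -(esum_tuple k A (fun ts => (\prod_(t <- ts) GW nu t)%R%:E)).
apply: fineK_le1; first by apply: esum_ge0 => t _; rewrite lee_fin prod_GW_ge0.
by rewrite (esum_tuple k A (fun ts => (\prod_(t <- ts) GW nu t)%R%:E)) iid_le1.
Qed.

Lemma PSE k m : (PS nu k m)%:E =
  \esum_(ts in [set ts | size ts = k /\ (\sum_(t <- ts) lambda t)%N = m])
    (\prod_(t <- ts) GW nu t)%R%:E.
Proof. exact: (Pr_iidE k [set ts : seq tree | (\sum_(t <- ts) lambda t)%N = m]). Qed.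

Lemma PS1E m : (PS nu 1 m)%:E = \esum_(t in [set t | lambda t = m]) (GW nu t)%:E.
Proof.
rewrite PSE (reindex_esum [set t | lambda t = m] _ (fun t => [:: t])).
  by apply: eq_esum => t _; rewrite big_seq1.
split=> [t /= tm|t u _ _ []//|[|t [|u s]] [//= _ e]]; first by rewrite big_seq1.
by exists t => //; rewrite big_seq1 in e.
Qed.

Lemma PS1_Pr m : PS nu 1 m = Pr (GW nu) [set t | lambda t = m].
Proof. by apply: EFin_inj; rewrite PS1E esum_GW_fine. Qed.

Lemma PS_ge0 k m : (0 <= PS nu k m)%R.
Proof.
by rewrite -lee_fin PSE; apply: esum_ge0 => t _; rewrite lee_fin prod_GW_ge0.
Qed.

End GaltonWatson.

(** * Trees with a marked branch point and lists of components *)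

Section CutDecomposition.
Context {R : realType}.
Variable nu : nat -> R.
Hypotheses (nu_law : is_law nu) (nu0 : 0 < nu 0%N).

Let nu_ge0 k : 0 <= nu k. Proof. by case: nu_law. Qed.

(* [us] lists the components of a split of a tree with [m] leaves: the first
one gets the split vertex as an additional leaf. *)
Definition split_forests (m : nat) : set (seq tree) :=
  [set us | (2 <= size us)%N /\ (\sum_(u <- us) lambda u)%N = m.+1].

(* The truncated subtractions keep this weight nonnegative when [us] has fewer
than two trees. *)
Definition split_mass (m : nat) (us : seq tree) : R :=
  (size us - 2)%:R / (size us)%:R * nu (size us).-1 * (m.+1%:R / m.-1%:R) /
  nu 0%N * \prod_(u <- us) GW nu u.

Lemma split_mass_ge0 m us : 0 <= split_mass m us.
Proof.
have nu0' := ltW nu0.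
by rewrite /split_mass !mulr_ge0 ?prod_GW_ge0 ?invr_ge0.
Qed.

Local Open Scope ereal_scope.

Lemma esum_vertices (t : tree) (p : pred vertex) (f : vertex -> \bar R) :
  (forall v, 0 <= f v) ->
  \sum_(v <- vertices t | p v) f v =
  \esum_(v in [set v | v \in vertices t /\ p v]) f v.
Proof.
move=> f0; rewrite -big_filter esum_uniq_seq ?filter_uniq ?uniq_vertices//.
apply: eq_esum_set; apply/seteqP; split=> v /=; rewrite mem_filter.
  by move=> /andP[].
by move=> [-> ->].
Qed.

(* A tree with a marked branch point [v] is the same as a tree with a marked
leaf [v], on which the subtrees above [v] are grafted. *)
Lemma graft_bij m :
  set_bij
    [set z : seq tree * vertex | split_forests m z.1 /\
       (z.2 \in vertices (head leaf z.1) /\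
        kids (subtree (head leaf z.1) z.2) == [::])]
    [set z : tree * vertex | lambda z.1 = m /\
       (z.2 \in vertices z.1 /\ kids (subtree z.1 z.2) != [::])]
    (fun z => (graft (head leaf z.1) z.2 (behead z.1), z.2)).
Proof.
split.
- move=> [[|u us] v] [[/= us0 usm] [vu sub_v]] //=.
  rewrite graft_vertices// subtree_graft.
  have := lambda_graft us vu; rewrite lambdaE.
  case: us us0 usm => // u1 us _; rewrite big_cons /=.
  case: (subtree u v) sub_v => ts /= /eqP ->.
  by rewrite lambdaE /= => usm e; split=> //; lia.
- move=> [us v] [us' v'] /set_mem[/= [us2 _] [vu sub_v]].
  move=> /set_mem[/= [us2' _] [v'u' sub_v']] [e vv'].
  rewrite -{}vv' in v'u' sub_v' e *.
  case: us us' us2 us2' vu v'u' sub_v sub_v' e => [|u us] [|u' us']//=.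
  move=> _ _ vu v'u' sub_v sub_v' e.
  have := congr1 (subtree^~ v) e; rewrite !subtree_graft => -[<-].
  have := congr1 (fun t => graft t v [::]) e; rewrite !graft_graft.
  by rewrite -{1}(eqP sub_v) -{1}(eqP sub_v') !graft_kids// => ->.
- move=> [t v] [/= tm [vt kv]]; exists (graft t v [::] :: kids (subtree t v), v).
    rewrite /= graft_vertices// subtree_graft /split_forests /= big_cons.
    do !split=> //; first by case: (kids _) kv.
    have := lambda_graft [::] vt; rewrite lambdaE /=.
    case: (subtree t v) kv => ts /= ts0; rewrite lambdaE (negPf ts0); lia.
  by rewrite /= graft_graft graft_kids.
Qed.

(** Pairs of a tree and a branch point are reindexed by [graft_bij]. The summand then no longer
    depends on the marked leaf of the first component, and summing over this leaf produces the
    factor [lambda (head leaf us)]. *)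
Lemma cut_decomposition m (f : seq tree -> \bar R) :
  (forall us, 0 <= f us) ->
  \esum_(t in [set t | lambda t = m]) ((GW nu t)%:E *
    \sum_(v <- vertices t | kids (subtree t v) != [::])
       f (graft t v [::] :: kids (subtree t v))) =
  \esum_(us in split_forests m) ((lambda (head leaf us))%:R%:E *
    ((nu (size us).-1 / nu 0%N * \prod_(u <- us) GW nu u)%R%:E * f us)).
Proof.
move=> f0; have GW0 t : 0 <= (GW nu t)%:E by rewrite lee_fin GW_ge0.
pose F (z : tree * vertex) := (GW nu z.1)%:E *
  f (graft z.1 z.2 [::] :: kids (subtree z.1 z.2)).
have F0 z : 0 <= F z by exact: mule_ge0.
under eq_esum => t _.
  rewrite esum_vertices// -esumZl//.
  over.
rewrite (esum_esum (a := fun t v => F (t, v)))//=.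
have -> : [set t | lambda t = m] `*`` (fun t =>
    [set v | v \in vertices t /\ kids (subtree t v) != [::]]) =
  [set z : tree * vertex | lambda z.1 = m /\
       (z.2 \in vertices z.1 /\ kids (subtree z.1 z.2) != [::])].
  by apply/seteqP; split=> -[].
rewrite (reindex_esum _ _ _ _ (graft_bij m)).
pose c us := (nu (size us).-1 / nu 0%N * \prod_(u <- us) GW nu u)%R%:E * f us.
have c0 us : 0 <= c us.
  by rewrite mule_ge0// lee_fin mulr_ge0 ?divr_ge0 ?prod_GW_ge0// ltW.
transitivity (\esum_(z in [set z : seq tree * vertex | split_forests m z.1 /\
       (z.2 \in vertices (head leaf z.1) /\
        kids (subtree (head leaf z.1) z.2) == [::])]) c z.1).
  apply: eq_esum => -[[|u us] v] [[//= _ _] [vu sub_v]].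
  rewrite /F /c /= subtree_graft graft_graft -(eqP sub_v) graft_kids//=.
  congr (_%:E * _); rewrite big_cons.
  (* The subtree at [v] is a leaf, of weight [nu 0], replaced by [Node us], whose root has weight
     [nu (size us)]: this is the origin of the ratio. *)
  have := GW_graft nu us vu; case: (subtree u v) sub_v => ts /= /eqP ->.
  rewrite !GW_Node big_nil mulr1 => e.
  apply: (mulIf (lt0r_neq0 nu0)); rewrite e.
  by field; rewrite lt0r_neq0.
rewrite (esum_pair _ (f := fun z => c z.1))//=.
rewrite [RHS]esum_mkcond; apply: eq_esum => us _; case: ifPn => usm; last first.
  by rewrite esum1// => v [us_m _]; case/negP: usm; exact: mem_set.
transitivity (\esum_(v in [set v | v \in vertices (head leaf us) /\
    kids (subtree (head leaf us) v) == [::]]) c us).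
  apply: eq_esum_set; apply/seteqP; split=> v /=; first by case.
  by rewrite inE in usm.
rewrite -(esum_vertices (head leaf us) _ (f := fun=> c us))//.
rewrite -[LHS]big_filter; set s := [seq _ <- vertices _ | _].
have -> : lambda (head leaf us) = size s.
  rewrite /lambda /nleaves /s size_filter. apply: eq_in_count => v vt.
  by rewrite nchildrenE// size_eq0.
elim: s => [|v s IH]; first by rewrite big_nil mul0e.
by rewrite big_cons IH /= -addn1 natrD addrC EFinD ge0_muleDl ?mul1e ?lee_fin.
Qed.

(** The selection probability is absorbed into [f] before [cut_decomposition] is applied. On lists
    of a fixed length [k.+1], which have [m.+1] leaves in total, invariance under rotation lets
    [esum_head] replace the leaves of the first tree by their average. *)
Lemma split_mass_identity m (f : seq tree -> \bar R) :
  (forall us, 0 <= f us) -> (forall us i, f (rot i us) = f us) ->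
  \esum_(t in [set t | lambda t = m]) ((GW nu t)%:E *
    \sum_(v <- vertices t | kids (subtree t v) != [::])
      (((size (kids (subtree t v))).-1%:R / m.-1%:R)%R%:E *
       f (graft t v [::] :: kids (subtree t v)))) =
  \esum_(us in split_forests m) ((split_mass m us)%:E * f us).
Proof.
move=> f0 frot; have nu0' := ltW nu0.
(* With [k] children there are [k + 1] components, so [k - 1] is [size us - 2]. *)
pose g us : \bar R := ((size us - 2)%:R / m.-1%:R)%R%:E * f us.
have g0 us : 0 <= g us by rewrite mule_ge0// lee_fin divr_ge0.
transitivity (\esum_(t in [set t | lambda t = m]) ((GW nu t)%:E *
    \sum_(v <- vertices t | kids (subtree t v) != [::])
      g (graft t v [::] :: kids (subtree t v)))).
  apply: eq_esum => t _; congr (_ * _); apply: eq_bigr => v kv.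
  by rewrite /g /= subSS subn1.
rewrite cut_decomposition// (esum_fibers _ size) => [|us]; last first.
  by rewrite !mule_ge0// lee_fin// mulr_ge0 ?divr_ge0 ?prod_GW_ge0.
rewrite [RHS](esum_fibers _ size) => [|us]; last first.
  by rewrite mule_ge0// lee_fin split_mass_ge0.
apply: eq_esum => -[|k] _.
  by rewrite !esum1// => us [[us2 _] /= us0]; rewrite us0 in us2.
pose A := split_forests m `&` [set us | size us = k.+1].
pose h us := (nu (size us).-1 / nu 0%N * \prod_(u <- us) GW nu u)%R%:E * g us.
have h0 us : 0 <= h us.
  by rewrite mule_ge0// lee_fin mulr_ge0 ?divr_ge0 ?prod_GW_ge0.
have headE : k.+1%:R%:E * (\esum_(us in A) ((lambda (head leaf us))%:R%:E * h us)) =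
    \esum_(us in A) ((\sum_(u <- us) lambda u)%N%:R%:E * h us).
  have p i (us : seq tree) : perm_eq (rot i us) us by rewrite perm_rot.
  apply: esum_head => // [us []//|us i [[us2 usm] usk]|us i].
    split; last by rewrite /= size_rot.
    by split; [rewrite size_rot|rewrite (perm_big _ (p i us))].
  by rewrite /h /g size_rot frot (perm_big _ (p i us)).
have -> : \esum_(us in A) ((lambda (head leaf us))%:R%:E * h us) =
    (k.+1%:R^-1)%R%:E * \esum_(us in A) ((\sum_(u <- us) lambda u)%N%:R%:E * h us).
  by rewrite -headE muleA -EFinM mulVf ?mul1e// pnatr_eq0.
rewrite -esumZl//; last by move=> us; rewrite mule_ge0// lee_fin.
apply: eq_esum => us [[_ ->] usk].
rewrite /h /g !muleA -!EFinM; congr (_%:E * _).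
rewrite /split_mass usk; ring.
Qed.

End CutDecomposition.

(** * The splitting law *)

(** The list [us] consists of [k + 1] components, so [size us - 3] is the number [k - 2] of added
    singletons. *)
Definition ranked_blocks (us : seq tree) : seq nat :=
  sort geq [seq bar (lambda t) | t <- us] ++ nseq (size us - 3) 1%N.

Lemma size_ranked_blocks us :
  size (ranked_blocks us) = (size us + (size us - 3))%N.
Proof. by rewrite size_cat size_sort size_map size_nseq. Qed.

(** The number of blocks is [2k - 1] for [k >= 2], but 2 for [k = 1], where the truncated
    subtraction gives 0; halving recovers [k] in both cases. *)
Lemma half_size_ranked_blocks us : (2 <= size us)%N ->
  (size (ranked_blocks us)).+1./2.+1 = size us.
Proof. rewrite size_ranked_blocks; lia. Qed.

Lemma barK m : (0 < m)%N -> (bar m).+1./2 = m.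
Proof. rewrite /bar; lia. Qed.

Section SplitLaw.
Context {R : realType}.
Variable nu : nat -> R.
Hypotheses (nu_law : is_law nu) (nu0 : 0 < nu 0%N).

Let nu_ge0 k : 0 <= nu k. Proof. by case: nu_law. Qed.

(* As [(bar m).+1./2 = m], the halves below are the numbers [m] of leaves and
[k] of children of the split vertex. *)
Definition split_law (N : nat) (p : seq nat) : R :=
  let m := N.+1./2 in let k := (size p).+1./2 in
  (k%:R - 1) / (k%:R + 1) * nu k * ((m%:R + 1) / (m%:R - 1)) *
  (PS nu k.+1 m.+1 / (nu 0%N * PS nu 1 m)) * block_sizes nu m k p.

(** Multiplying by the probability of the conditioning event undoes the conditioning; if this
    probability is 0, both sides vanish. *)
Lemma block_sizesE m k p :
  (PS nu k.+1 m.+1 * block_sizes nu m k p)%:E =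
  \esum_(us in [set us | size us = k.+1 /\
     ((\sum_(u <- us) lambda u)%N = m.+1 /\ ranked_blocks us = p)])
    (\prod_(u <- us) GW nu u)%:E.
Proof.
have [PS0|PS_neq0] := eqVneq (PS nu k.+1 m.+1) 0.
  rewrite PS0 mul0r; apply/esym/le_anti/andP; split; last first.
    by apply: esum_ge0 => us _; rewrite lee_fin prod_GW_ge0.
  rewrite -PS0 PSE//; apply: le_esum_subset => [us|us [? []]]//.
  by rewrite lee_fin prod_GW_ge0.
rewrite -(Pr_iidE nu_law k.+1 [set us |
  (\sum_(u <- us) lambda u)%N = m.+1 /\ ranked_blocks us = p]).
congr EFin; rewrite /block_sizes /image_law /cond.
rewrite -/(PS nu k.+1 m.+1) /Pr.
pose A := [set ts : k.+1.-tuple tree | sum_leaves ts = m.+1].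
pose B := [set ts : k.+1.-tuple tree | ranked_blocks ts = p].
have -> : [set ts : k.+1.-tuple tree |
   (sort geq [seq bar (lambda t) | t <- ts] ++ nseq (k - 2) 1%N) = p] = B.
  by rewrite /B /ranked_blocks; apply/seteqP; split=> ts /=; rewrite size_tuple subSS.
rewrite [X in _ = fine (esum X _)](_ : _ = B `&` A); last first.
  by apply/seteqP; split=> ts /= [].
rewrite esum_mkcondr.
have -> : \esum_(ts in B) (\1_A ts * iid (GW nu) ts / PS nu k.+1 m.+1)%:E =
    ((PS nu k.+1 m.+1)^-1%:E * \esum_(ts in B)
     (if ts \in A then (iid (GW nu) ts)%:E else 0))%E.
  rewrite -esumZl ?lee_fin ?invr_ge0 ?PS_ge0// => [|ts]; last first.
    by case: ifP; rewrite // lee_fin /iid prod_GW_ge0.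
  apply: eq_esum => ts _; rewrite indicE; case: (ts \in A).
    by rewrite mul1r mulrC EFinM.
  by rewrite !mul0r mule0.
rewrite -esum_mkcondr fineM//= ?mulVKf//.
rewrite ge0_fin_numE ?esum_ge0// => [|ts _]; last by rewrite lee_fin /iid prod_GW_ge0.
apply: (@le_lt_trans _ _ 1%E); last exact: ltry.
apply: le_trans (iid_le1 nu_law k.+1 setT).
rewrite -(esum_tuple k.+1 setT (fun ts => (\prod_(t <- ts) GW nu t)%:E)).
by apply: le_esum_subset => // ts; rewrite lee_fin prod_GW_ge0.
Qed.

(** Fixing [p] fixes the number of components, hence every factor of [split_mass] except the product
    of weights, which is summed by [block_sizesE]. *)
Lemma split_lawE m p : (2 <= m)%N -> 0 < PS nu 1 m ->
  (split_law (bar m) p)%:E =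
  \esum_(us in split_forests m `&` [set us | ranked_blocks us = p])
    (split_mass nu m us / PS nu 1 m)%:E.
Proof.
move=> m2 PS1.
have m1 : m.-1%:R = m%:R - 1 :> R by rewrite -subn1 natrB//; apply: ltnW.
rewrite /split_law barK ?(ltnW m2)//; set k := (size p).+1./2.
set c := (X in X * nu k).
have -> : c * nu k * ((m%:R + 1) / (m%:R - 1)) *
    (PS nu k.+1 m.+1 / (nu 0%N * PS nu 1 m)) * block_sizes nu m k p =
  (c * nu k * (m.+1%:R / m.-1%:R) / nu 0%N / PS nu 1 m) *
  (PS nu k.+1 m.+1 * block_sizes nu m k p).
  by rewrite invfM m1 natr1; ring.
rewrite EFinM block_sizesE.
(* For [k = 0] the real number [k - 1] is negative and cannot be moved into the sum; both sums are
   then empty. *)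
have [k0|k_gt0] := posnP k.
  rewrite !esum1 ?mule0// => us.
    move=> [[us2 _] /= usp]; move: k0; rewrite /k -usp size_ranked_blocks; lia.
  move=> [us1 [_ /= usp]]; move: k0; rewrite /k -usp size_ranked_blocks us1; lia.
have k1 : 0 <= k%:R - 1 :> R by rewrite subr_ge0 ler1n.
have k2 : 0 <= k%:R + 1 :> R by rewrite addr_ge0.
have nu0' := ltW nu0; rewrite -esumZl; last 2 first.
- by rewrite lee_fin !mulr_ge0 ?invr_ge0 ?PS_ge0.
- by move=> us; rewrite lee_fin prod_GW_ge0.
have -> : [set us | size us = k.+1 /\
     ((\sum_(u <- us) lambda u)%N = m.+1 /\ ranked_blocks us = p)] =
  split_forests m `&` [set us | ranked_blocks us = p].
  apply/seteqP; split=> us /=.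
    by move=> [usk [usm usp]]; split=> //; split=> //; rewrite usk.
  move=> [[us2 ->] usp]; split=> //; by rewrite /k -usp half_size_ranked_blocks.
apply: eq_esum => us [[us2 _] /= usp].
have usk : size us = k.+1 by rewrite /k -usp half_size_ranked_blocks.
rewrite -EFinM /split_mass /c usk subSS natr1 natrB//=; congr EFin; ring.
Qed.

Local Open Scope ereal_scope.

Lemma esum_split_law m (f : seq nat -> \bar R) :
  (2 <= m)%N -> (0 < PS nu 1 m)%R -> (forall p, 0 <= f p) ->
  \esum_(p in [set: seq nat]) ((split_law (bar m) p)%:E * f p) =
  \esum_(us in split_forests m)
    ((split_mass nu m us / PS nu 1 m)%:E * f (ranked_blocks us)).
Proof.
move=> m2 PS1 f0; rewrite (esum_comp _ ranked_blocks (phi := f))//.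
  by apply: eq_esum => p _; rewrite split_lawE.
by move=> us; rewrite lee_fin divr_ge0 ?split_mass_ge0 ?ltW.
Qed.

Lemma split_law_ge0 m p :
  (2 <= m)%N -> (0 < PS nu 1 m)%R -> (0 <= split_law (bar m) p)%R.
Proof.
move=> m2 PS1; rewrite -lee_fin split_lawE//; apply: esum_ge0 => us _.
by rewrite lee_fin divr_ge0 ?split_mass_ge0 ?ltW.
Qed.

(** Taking [f = 1] in [split_mass_identity], the selection probabilities of each tree add up to 1,
    so [split_mass] has total mass [PS nu 1 m]. *)
Lemma split_law_total m : (2 <= m)%N -> (0 < PS nu 1 m)%R ->
  \esum_(p in [set: seq nat]) (split_law (bar m) p)%:E = 1.
Proof.
move=> m2 PS1; have := esum_split_law m2 PS1 (f := fun=> 1) (fun=> lee01).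
under eq_esum do rewrite mule1; move=> ->.
have := @split_mass_identity R nu nu_law nu0 m (fun=> 1) (fun=> lee01) (fun _ _ => erefl).
under eq_esum => t tm.
  rewrite (eq_bigr (fun v =>
    (((size (kids (subtree t v)))%:R - 1) / (m%:R - 1))%R%:E)); last first.
    move=> v kv; rewrite mule1 -!subn1 !natrB ?(ltnW m2)// lt0n size_eq0//.
  rewrite sumEFin -mulr_suml sum_branch_points tm divff ?mule1; last first.
    by rewrite subr_eq0 pnatr_eq1 gtn_eqF.
  over.
rewrite -PS1E// => e.
under eq_esum do rewrite mulrC mule1 EFinM.
rewrite esumZl ?lee_fin ?invr_ge0 ?ltW//; last first.
  by move=> us; rewrite lee_fin split_mass_ge0.
have -> : \esum_(us in split_forests m) (split_mass nu m us)%:E = (PS nu 1 m)%:E.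
  by rewrite e; apply: eq_esum => us _; rewrite mule1.
by rewrite -EFinM mulVf// lt0r_neq0.
Qed.

Lemma PS1_0 : PS nu 1 0 = 0%R.
Proof.
apply: EFin_inj; rewrite PS1E// esum1// => t /= t0.
by have := lambda_gt0 t; rewrite t0.
Qed.

(** The bounds on [markov_branching] involve all sizes [N]. When [m < 2] or [PS nu 1 m = 0], a
    division by 0 makes [split_law] vanish. *)
Lemma split_law_subprob N :
  (forall p, 0 <= split_law N p)%R /\
  \esum_(p in [set: seq nat]) (split_law N p)%:E <= 1.
Proof.
pose m := N.+1./2.
have [/andP[m2 PS1]|bad] := boolP ((2 <= m)%N && (0 < PS nu 1 m)%R).
  have NE p : split_law N p = split_law (bar m) p.
    by rewrite /split_law barK// ltnW.
  split=> [p|]; first by rewrite NE split_law_ge0.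
  by under eq_esum do rewrite NE; rewrite split_law_total.
have N0 p : split_law N p = 0%R.
  rewrite /split_law -/m; move: bad; rewrite negb_and -ltnNge => /orP[|].
    rewrite ltnS leq_eqVlt ltnS leqn0 => /orP[/eqP ->|/eqP ->].
      by rewrite subrr invr0 !(mulr0, mul0r).
    by rewrite PS1_0 mulr0 invr0 !(mulr0, mul0r).
  rewrite lt_neqAle PS_ge0// andbT negbK eq_sym => /eqP ->.
  by rewrite mulr0 invr0 !(mulr0, mul0r).
by split=> [p|]; [rewrite N0|rewrite esum1 ?lee01// => p _; rewrite N0].
Qed.

End SplitLaw.

(** With [k + 1] components, the sizes add up to [2(m + 1) - (k + 1) + (k - 2) = 2m - 1]. The
    subtraction in [size us - 3] is exact because there are at least three components. *)
Lemma is_partition_ranked_blocks m us : (3 <= size us)%N -> split_forests m us ->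
  is_partition (bar m) (ranked_blocks us).
Proof.
move=> us3 [_ usm].
have bar_gt0 t : (0 < bar (lambda t))%N by have := lambda_gt0 t; rewrite /bar; lia.
have geq_trans : transitive geq by move=> a b c /= ab ca; exact: leq_trans ca ab.
apply/and3P; split.
- rewrite sorted_pairwise// pairwise_cat -!sorted_pairwise//.
  apply/and3P; split.
  + apply/allrelP => a b; rewrite mem_sort => /mapP[t _ ->].
    by rewrite mem_nseq => /andP[_ /eqP ->]; exact: bar_gt0.
  + by apply: sort_sorted => a b; exact: leq_total.
  + by elim: (_ - _)%N => //= -[|r].
- rewrite all_cat all_nseq orbT andbT; apply/allP => a; rewrite mem_sort.
  by move=> /mapP[t _ ->]; exact: bar_gt0.
- rewrite sumn_cat sumn_nseq mul1n (perm_sumn (permEl (perm_sort _ _))).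
  have sumn_bar s :
    (sumn [seq bar (lambda t) | t <- s] + size s = 2 * \sum_(t <- s) lambda t)%N.
    elim: s => [|t s IH]; first by rewrite big_nil.
    rewrite big_cons /= mulnDr -IH /bar; have := lambda_gt0 t; lia.
  have := sumn_bar us; rewrite usm /bar => e; apply/eqP; move: us3 e; lia.
Qed.

(** * Support, number of blocks and conditional block sizes of the splitting law *)

Section SplittingProbabilities.
Context {R : realType}.
Variable nu : nat -> R.
Hypotheses (nu_law : is_law nu) (nu0 : 0 < nu 0%N).

Lemma PS1_gt0 t : GW nu t != 0 -> 0 < PS nu 1 (lambda t).
Proof.
move=> GWt; have GWt0 : 0 < GW nu t by rewrite lt_neqAle eq_sym GWt GW_ge0.
apply: lt_le_trans GWt0 _; rewrite -lee_fin PS1E//.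
exact: (@le_esum_term _ _ [set u | lambda u = lambda t] (fun t => (GW nu t)%:E)).
Qed.

(** A charged partition comes from a forest of nonzero mass; the factor [size us - 2] of
    [split_mass] then forces at least three trees. *)
Lemma split_law_support m p : (2 <= m)%N -> 0 < PS nu 1 m ->
  split_law nu (bar m) p != 0 ->
  exists us, [/\ (3 <= size us)%N, split_forests m us, ranked_blocks us = p &
    {in us, forall u, GW nu u != 0}].
Proof.
move=> m2 PS1 qp; apply: contrapT => no_us; case/eqP: qp.
apply: EFin_inj; rewrite split_lawE// esum1// => us [usm usp].
congr EFin; apply/eqP; apply: contrapT => /negP.
rewrite /split_mass !mulf_eq0 !negb_or => /andP[/andP[/andP[/andP[/andP[]]]]].
rewrite pnatr_eq0 => /andP[us2 _] _ _ _ prod0 _; apply: no_us; exists us.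
split=> // [|u uus]; first lia.
by move: prod0; rewrite prodf_seq_neq0 => /allP/(_ _ uus).
Qed.

Lemma split_law_splitting_probabilities :
  splitting_probabilities
    [set bar m | m in [set m | (1 <= m)%N /\ 0 < PS nu 1 m]] (split_law nu).
Proof.
move=> N [m [m1 PS1] <-]; rewrite /bar => m2'.
have m2 : (2 <= m)%N by lia.
rewrite -/(bar m); split=> [|p qp].
  by split=> [p|]; [exact: split_law_ge0|exact: split_law_total].
have [us [us3 usm <- GWus]] := split_law_support m2 PS1 qp.
split; first exact: is_partition_ranked_blocks.
move=> M; rewrite mem_cat mem_sort => /orP[/mapP[t tus ->]|].
  by exists (lambda t) => //; split; [exact: lambda_gt0|exact/PS1_gt0/GWus].
(* The added singletons have size [bar 1], an admissible size because [leaf] has weight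
   [nu 0 > 0]. *)
rewrite mem_nseq => /andP[_ /eqP ->]; exists 1%N => //; split=> //.
have -> : 1%N = lambda leaf by rewrite lambdaE.
by apply: PS1_gt0; rewrite GW_Node big_nil mulr1 lt0r_neq0.
Qed.

Lemma split_law_block_sizes m k p : (2 <= m)%N -> (2 <= k)%N -> size p = bar k ->
  split_law nu (bar m) p = (k%:R - 1) / (k%:R + 1) * nu k * ((m%:R + 1) / (m%:R - 1))
            * (PS nu k.+1 m.+1 / (nu 0%N * PS nu 1 m)) * block_sizes nu m k p.
Proof.
by move=> m2 k2 pk; rewrite /split_law pk !barK ?(ltnW m2) ?(ltnW k2).
Qed.

(** Every forest of [k.+1] trees yields [bar k] blocks, so the sum over [p] reaches all of them. *)
Lemma block_sizes_total m k : (2 <= k)%N ->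
  (\esum_(p in [set p | size p = bar k]) (PS nu k.+1 m.+1 * block_sizes nu m k p)%:E =
  (PS nu k.+1 m.+1)%:E)%E.
Proof.
move=> k2; under eq_esum do rewrite block_sizesE//.
rewrite PSE// [RHS](esum_fibers _ ranked_blocks); last first.
  by move=> us; rewrite lee_fin prod_GW_ge0.
rewrite -[RHS](eq_esum_supp (A := [set p | size p = bar k])).
  apply: eq_esum => p _; apply: eq_esum_set; apply/seteqP.
  by split=> us /= [usk]; [move=> [? ?]|move: usk => [? ?]].
move=> p p0; split=> // _; apply: contrapT => pk; apply: p0.
rewrite esum1// => us [[usk _] /= usp]; case: pk.
rewrite /= -usp size_ranked_blocks usk /bar; lia.
Qed.

Lemma Pr_split_law_size m k : (2 <= m)%N -> (2 <= k)%N ->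
  Pr (split_law nu (bar m)) [set p | size p = bar k] =
  (k%:R - 1) / (k%:R + 1) * nu k * ((m%:R + 1) / (m%:R - 1))
    * (PS nu k.+1 m.+1 / (nu 0%N * PS nu 1 m)).
Proof.
move=> m2 k2; set c := (X in X * (_ / _)).
rewrite /Pr; under eq_esum => p pk do rewrite (split_law_block_sizes m2 k2 pk).
have [PS0|PS_neq0] := eqVneq (PS nu k.+1 m.+1) 0.
  by rewrite PS0 mul0r mulr0 esum1// => p _; rewrite mul0r.
have k0 : 0 <= k%:R - 1 :> R by rewrite subr_ge0 ler1n ltnW.
have m0 : 0 <= m%:R - 1 :> R by rewrite subr_ge0 ler1n ltnW.
have [nu_ge0 _] := nu_law.
have d0 : 0 <= c / (nu 0%N * PS nu 1 m).
  have k1 : 0 <= k%:R + 1 :> R by rewrite addr_ge0.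
  have m1 : 0 <= m%:R + 1 :> R by rewrite addr_ge0.
  by rewrite /c !mulr_ge0 ?invr_ge0 ?mulr_ge0 ?PS_ge0.
have := block_sizes_total m k2.
set S := esum _ _ => SE.
have -> : \esum_(p in [set p | size p = bar k])
   (c * (PS nu k.+1 m.+1 / (nu 0%N * PS nu 1 m)) * block_sizes nu m k p)%:E =
   ((c / (nu 0%N * PS nu 1 m))%:E * S)%E.
  rewrite -esumZl// => [|p]; last first.
    by rewrite block_sizesE//; apply: esum_ge0 => us _; rewrite lee_fin prod_GW_ge0.
  by apply: eq_esum => p _; rewrite -EFinM; congr EFin; ring.
by rewrite SE -EFinM /=; ring.
Qed.

Lemma cond_split_law_size m k : (2 <= m)%N -> (2 <= k)%N ->
  0 < Pr (split_law nu (bar m)) [set p | size p = bar k] ->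
  cond (split_law nu (bar m)) [set p | size p = bar k] =1 block_sizes nu m k.
Proof.
move=> m2 k2; rewrite /cond Pr_split_law_size//; set c := _ * (_ / _) => c0 p.
rewrite indicE; case: (boolP (p \in _)) => pk.
  rewrite inE in pk; rewrite (split_law_block_sizes m2 k2 pk) -/c mul1r.
  by rewrite mulrAC divff ?mul1r// lt0r_neq0.
rewrite !mul0r; have [PS0|PS_neq0] := eqVneq (PS nu k.+1 m.+1) 0.
  by move: c0; rewrite /c PS0 mul0r mulr0 ltxx.
(* Outside the conditioning event, [block_sizes] must vanish: [k.+1] trees cannot yield a partition
   of another length. *)
apply: (mulfI PS_neq0); rewrite mulr0; apply: EFin_inj.
rewrite block_sizesE// esum1// => us [usk [_ usp]]; case/negP: pk; rewrite inE /=.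
rewrite -usp size_ranked_blocks usk /bar; lia.
Qed.

End SplittingProbabilities.

(** * Markov branching trees and cut-trees up to isomorphism *)

Section MarkovBranching.
Context {R : realType}.

Lemma meanE (T : choiceType) (mu f : T -> R) :
  (forall x, 0 <= mu x) -> (\esum_(x in [set: T]) (mu x)%:E <= 1)%E ->
  (forall x, 0 <= f x <= 1) ->
  (mean mu f)%:E = (\esum_(x in [set: T]) ((mu x)%:E * (f x)%:E))%E.
Proof.
move=> mu0 mu1 f01; apply: fineK_le1.
  by apply: esum_ge0 => x _; rewrite lee_fin mulr_ge0//; case/andP: (f01 x).
apply: le_trans mu1; apply: le_esum => x _; rewrite lee_fin ler_piMr//.
by case/andP: (f01 x).
Qed.

Lemma mean_ge0_le1 (T : choiceType) (mu f : T -> R) :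
  (forall x, 0 <= mu x) -> (\esum_(x in [set: T]) (mu x)%:E <= 1)%E ->
  (forall x, 0 <= f x <= 1) -> 0 <= mean mu f <= 1.
Proof.
move=> mu0 mu1 f01; rewrite -!lee_fin meanE//; apply/andP; split.
  by apply: esum_ge0 => x _; rewrite mule_ge0// lee_fin//; case/andP: (f01 x).
apply: le_trans mu1; apply: le_esum => x _; rewrite lee_fin ler_piMr//.
by case/andP: (f01 x).
Qed.

Variable q : nat -> seq nat -> R.
Hypothesis q_subprob : forall N, (forall p, 0 <= q N p) /\
  (\esum_(p in [set: seq nat]) (q N p)%:E <= 1)%E.

Let q_ge0 N p : 0 <= q N p. Proof. by case: (q_subprob N). Qed.
Let q_le1 N : (\esum_(p in [set: seq nat]) (q N p)%:E <= 1)%E.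
Proof. by case: (q_subprob N). Qed.

Lemma markov_branchingE N ss :
  markov_branching q N (Node ss) =
  (if N == 1%N then (ss == [::])%:R else
   mean (q N) (fun p => indep_mass (markov_branching q) p ss)).
Proof. by case: N. Qed.

Lemma markov_branching_ge0_le1 N s : 0 <= markov_branching q N s <= 1.
Proof.
elim/tree_seq_ind: s N => ss IH N; rewrite markov_branchingE; case: ifP => _.
  by case: eqP; rewrite ?lexx ?ler01.
apply: mean_ge0_le1 => // p.
by apply: indep_mass_le1 => s sss M; exact: IH.
Qed.

Let markov_ge0 N s : 0 <= markov_branching q N s.
Proof. by case/andP: (markov_branching_ge0_le1 N s). Qed.

Local Open Scope ereal_scope.

Definition markov_law (N : nat) (x : tree) : \bar R :=
  \esum_(s in [set s | canon s = x]) (markov_branching q N s)%:E.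

Lemma markov_law_ge0 N x : 0 <= markov_law N x.
Proof. by apply: esum_ge0 => s _; rewrite lee_fin. Qed.

Lemma canon_leaf s : canon s = leaf -> s = leaf.
Proof.
by case: s => ts [] /(congr1 size); rewrite size_sort size_map => /size0nil ->.
Qed.

Lemma esum_canon_Node (zs : seq tree) (f : tree -> \bar R) :
  \esum_(s in [set s | canon s = Node (sort tree_le zs)]) f s =
  \esum_(ss in [set ss | perm_eq (map canon ss) zs]) f (Node ss).
Proof.
rewrite esum_Node; apply: eq_esum_set; apply/seteqP; split=> ss /=.
  by move=> [/eqP]; rewrite sort_tree_le.
by rewrite -sort_tree_le => /eqP ->.
Qed.

Lemma markov_law1 x : markov_law 1 x = if x == leaf then 1 else 0.
Proof.
case: eqP => [->|x_leaf]; last first.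
  apply: esum1 => -[ss] ssx; rewrite markov_branchingE eqxx.
  by case: eqP => // ss0; case: x_leaf; rewrite -ssx ss0.
rewrite /markov_law (_ : [set s | canon s = leaf] = [set leaf]); last first.
  by apply/seteqP; split=> s /=; [exact: canon_leaf|move=> ->].
by rewrite esum_set1 ?lee_fin// /leaf markov_branchingE.
Qed.

(** Given the partition, the canonical forms of the subtrees are independent by [esum_prodE_image],
    and only their multiset matters. *)
Lemma markov_law_Node N zs : N != 1%N ->
  markov_law N (Node (sort tree_le zs)) =
  \esum_(p in [set: seq nat]) ((q N p)%:E *
    \esum_(ys in [set ys | perm_eq ys zs]) prodE markov_law p ys).
Proof.
move=> N1; rewrite /markov_law esum_canon_Node.
under eq_esum => ss _.
  rewrite markov_branchingE (negPf N1) meanE//; last first.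
    by move=> p; apply: indep_mass_le1 => s _ M; exact: markov_branching_ge0_le1.
  over.
rewrite exchange_esum; last first.
  by move=> ss p; rewrite mule_ge0// lee_fin ?indep_mass_ge0.
apply: eq_esum => p _; rewrite esumZl ?lee_fin// => [|ss]; last first.
  by rewrite lee_fin indep_mass_ge0.
congr (_ * _); under eq_esum do rewrite indep_massE.
by rewrite (esum_prodE_image canon [set ys | perm_eq ys zs] p).
Qed.

End MarkovBranching.

Section CutLaw.
Context {R : realType}.

Lemma cut_circ_ge0 t s : 0 <= cut_circ (vertices t) s :> R.
Proof. by case/andP: (@cut_circ_ge0_le1 R t s). Qed.

Lemma cut_HWE t y : (cut_HW t y)%:E =
  (\esum_(s in [set s | add_singletons s = y]) (cut_circ (vertices t) s : R)%:E)%E.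
Proof.
rewrite /cut_HW /image_law /Pr fineK//.
have [[s <-]|no_s] := pselect (exists s, add_singletons s = y).
  rewrite (_ : [set _ | _] = [set s]) ?esum_set1 ?lee_fin ?cut_circ_ge0//.
  by apply/seteqP; split=> u /=; [move/add_singletons_inj|move=> ->].
by rewrite esum1// => s sy; case: no_s; exists s.
Qed.

Lemma cut_HW_ge0_le1 t y : 0 <= (cut_HW t y : R) <= 1.
Proof.
rewrite -!lee_fin cut_HWE.
have [[s <-]|no_s] := pselect (exists s, add_singletons s = y).
  rewrite (_ : [set _ | _] = [set s]) ?esum_set1 ?lee_fin ?cut_circ_ge0_le1
    ?cut_circ_ge0//.
  by apply/seteqP; split=> u /=; [move/add_singletons_inj|move=> ->].
by rewrite esum1 ?lexx ?lee01// => s sy; case: no_s; exists s.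
Qed.

Local Open Scope ereal_scope.

Definition cut_law (t x : tree) : \bar R :=
  \esum_(s in [set s | canon (add_singletons s) = x])
    (cut_circ (vertices t) s)%:E.

Lemma cut_law_ge0 t x : 0 <= cut_law t x.
Proof. by apply: esum_ge0 => s _; rewrite lee_fin cut_circ_ge0. Qed.

(* The lists of children of a block which, once the singletons are added, give
the list [zs] up to order. *)
Definition unpadded (zs : seq tree) : set (seq tree) :=
  [set ys | perm_eq (ys ++ nseq (size ys - 3) leaf) zs].

Lemma cut_law_leaf x : cut_law leaf x = if x == leaf then 1 else 0.
Proof.
rewrite /cut_law esum_Node.
under eq_esum do rewrite cut_circ_vertices /=.
case: eqP => [->|x_leaf]; last first.
  apply: esum1 => ss ssx; case: eqP => // ss0; case: x_leaf.
  by rewrite -ssx ss0.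
rewrite (_ : [set _ | _] = [set [::]]) ?esum_set1 ?lee_fin//.
apply/seteqP; split=> [ss|ss ->//]; rewrite /= map_cat map_nseq -map_comp.
by move=> [] /(congr1 size); rewrite size_sort size_cat size_map; case: ss.
Qed.

(** The analogue of [markov_law_Node] for a fixed tree, where the padding is carried by [unpadded]
    and [ys] lists only the genuine components. *)
Lemma cut_law_Node t zs : kids t != [::] ->
  cut_law t (Node (sort tree_le zs)) =
  \sum_(v <- vertices t | kids (subtree t v) != [::])
    (((size (kids (subtree t v))).-1%:R / (lambda t).-1%:R)%R%:E *
     \esum_(ys in unpadded zs)
       prodE cut_law (graft t v [::] :: kids (subtree t v)) ys).
Proof.
move=> t0; rewrite /cut_law esum_Node.
have -> : [set ss | canon (add_singletons (Node ss)) = Node (sort tree_le zs)] =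
    [set ss | unpadded zs (map (canon \o add_singletons) ss)].
  rewrite /unpadded; apply/seteqP; split=> ss; rewrite /= size_map -sort_tree_le.
    by rewrite map_cat map_nseq -map_comp => -[/eqP].
  by rewrite map_cat map_nseq -map_comp => /eqP ->.
have ind_ge0 us ss : (0 <= indep_mass (fun u => cut_circ (vertices u)) us ss :> R)%R.
  by apply: indep_mass_ge0 => *; exact: cut_circ_ge0.
have n1 n : (0 < n)%N -> n.-1%:R = (n%:R - 1)%R :> R.
  by move=> n0; rewrite -subn1 natrB.
have c_ge0 (v : vertex) : 
  (0 <= (size (kids (subtree t v))).-1%:R / (lambda t).-1%:R :> R)%R by [].
under eq_esum => ss _.
  rewrite cut_circ_vertices (negPf t0) -sumEFin.
  rewrite (eq_bigr (fun v =>
    ((size (kids (subtree t v))).-1%:R / (lambda t).-1%:R)%R%:E *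
    prodE (fun u s => (cut_circ (vertices u) s)%:E)
      (graft t v [::] :: kids (subtree t v)) ss)); last first.
    move=> v kv; rewrite !n1 ?lambda_gt0// ?lt0n ?size_eq0//.
    by rewrite -indep_massE -EFinM.
  over.
rewrite esum_sum => [|ss v _ _]; last first.
  by rewrite mule_ge0 ?lee_fin// -indep_massE lee_fin.
apply: eq_bigr => v kv; rewrite esumZl ?lee_fin// => [|ss]; last first.
  by rewrite -indep_massE lee_fin.
congr (_ * _); rewrite (esum_prodE_image (canon \o add_singletons) (unpadded zs))//.
by move=> *; rewrite lee_fin cut_circ_ge0.
Qed.

End CutLaw.

(** * Comparison of the two recursions *)

Section Recursion.
Context {R : realType}.
Variable nu : nat -> R.
Hypotheses (nu_law : is_law nu) (nu0 : 0 < nu 0%N).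
Local Open Scope ereal_scope.

Let GW0 t : 0 <= (GW nu t)%:E. Proof. by rewrite lee_fin GW_ge0. Qed.

(* The weight [split_mass] only depends on the kernel [K] through its averages
over the trees with a given number of leaves. *)
Lemma esum_split_mass m zs (K : tree -> tree -> \bar R) :
  (forall u y, 0 <= K u y) ->
  \esum_(us in split_forests m) ((split_mass nu m us)%:E *
    \esum_(ys in unpadded zs) prodE K us ys) =
  \esum_(ys in unpadded zs)
    (((size ys - 2)%:R / (size ys)%:R * nu (size ys).-1 *
      (m.+1%:R / m.-1%:R) / nu 0%N)%R%:E *
     \esum_(js in [set js | (2 <= size js)%N /\ sumn js = m.+1])
       prodE (fun y j => \esum_(u in [set u | lambda u = j])
                ((GW nu u)%:E * K u y)) ys js).
Proof.
move=> K0; have prod0 us ys : 0 <= prodE K us ys by exact: prodE_ge0.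
have [nu_ge0 _] := nu_law.
under eq_esum => us _.
  rewrite -esumZl// ?lee_fin ?split_mass_ge0//.
  over.
rewrite exchange_esum => [|us ys]; last by rewrite mule_ge0// lee_fin split_mass_ge0.
apply: eq_esum => ys _.
have wK0 y u : 0 <= (GW nu u)%:E * K u y by rewrite mule_ge0.
rewrite -(esum_prodE_image lambda [set js | (2 <= size js)%N /\ sumn js = m.+1]
  (K := fun y u => (GW nu u)%:E * K u y))//.
rewrite -esumZl => [||us]; last 2 first.
- by rewrite lee_fin !mulr_ge0 ?invr_ge0// ltW.
- exact: prodE_ge0.
rewrite (_ : [set us | _] = split_forests m); last first.
  by apply/seteqP; split=> us; rewrite /split_forests /= size_map sumnE big_map.
apply: eq_esum => us _; rewrite -prodE_flip -prod_GWE.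
have [sz|/eqP sz] := eqVneq (size us) (size ys); last first.
  by rewrite !prodE_size ?mule0.
by rewrite /split_mass sz EFinM muleA.
Qed.

(** This lets the cut law be replaced by the Markov branching law inside a split. Equality of
    averages is asked only at [zs], the canonical subtrees to which an induction on shapes
    applies. *)
Lemma eq_esum_split_mass m zs (K K' : tree -> tree -> \bar R) :
  (forall u y, 0 <= K u y) -> (forall u y, 0 <= K' u y) ->
  {in zs, forall y j,
    \esum_(u in [set u | lambda u = j]) ((GW nu u)%:E * K u y) =
    \esum_(u in [set u | lambda u = j]) ((GW nu u)%:E * K' u y)} ->
  \esum_(us in split_forests m) ((split_mass nu m us)%:E *
    \esum_(ys in unpadded zs) prodE K us ys) =
  \esum_(us in split_forests m) ((split_mass nu m us)%:E *
    \esum_(ys in unpadded zs) prodE K' us ys).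
Proof.
move=> K0 K'0 KK'; rewrite !esum_split_mass//; apply: eq_esum => ys yszs.
congr (_ * _); apply: eq_esum => js _; apply: eq_prodE => y yys j.
by apply: KK'; rewrite -(perm_mem yszs) mem_cat yys.
Qed.

Hypothesis nu1 : nu 1%N = 0%R.

(** A root with one child has weight 0 since [nu 1 = 0], and a root with two children or more has at
    least two leaves. *)
Lemma lambda1 t : lambda t = 1%N -> GW nu t != 0%R -> t = leaf.
Proof.
case: t => -[//|t [|u ts]]; first by rewrite GW_Node /= nu1 mul0r eqxx.
rewrite lambdaE /= !big_cons; have := lambda_gt0 t; have := lambda_gt0 u; lia.
Qed.

Let H := markov_law (split_law nu).

Let H0 N x : 0 <= H N x.
Proof. by apply: markov_law_ge0; exact: split_law_subprob. Qed.

Lemma esum_markov_ranked_blocks zs us :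
  \esum_(ys in [set ys | perm_eq ys zs]) prodE H (ranked_blocks us) ys =
  \esum_(ys in unpadded zs) prodE (fun u => H (bar (lambda u))) us ys.
Proof.
rewrite (esum_prodE_cat_nseq (y0 := leaf))//; last first.
  by move=> y; apply: markov_law1; exact: split_law_subprob.
rewrite (esum_prodE_perm (xs' := [seq bar (lambda t) | t <- us]))//; last 2 first.
- move=> ys ys' p /=; apply: perm_trans.
  by rewrite perm_cat2r perm_sym.
- by rewrite perm_sort.
under eq_esum do rewrite prodE_mapl.
(* The padding is computed from [size us] on one side and from [size ys] on the other; these agree
   wherever the product is nonzero. *)
apply: eq_esum_supp => ys prod_neq0.
have -> : size us = size ys by apply: contrapT => /prodE_size.
by [].
Qed.

(** The laws agree on average over the trees with [m] leaves. The induction is on the shape [s], for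
    all [m] at once, since components have various numbers of leaves. Both sides become sums of
    [split_mass] over [split_forests m], by [split_mass_identity] and [esum_split_law]. *)
Lemma cut_law_markov_law s m :
  \esum_(t in [set t | lambda t = m]) ((GW nu t)%:E * cut_law t (canon s)) =
  \esum_(t in [set t | lambda t = m]) ((GW nu t)%:E * H (bar m) (canon s)).
Proof.
elim/tree_seq_ind: s m => ss IH m.
have [m2|m1] := leqP 2 m; last first.
  apply: eq_esum => t /= tm; have [->|GWt] := eqVneq (GW nu t) 0%R.
    by rewrite !mul0e.
  have m_eq1 : m = 1%N by have := lambda_gt0 t; lia.
  rewrite m_eq1 in tm *; rewrite (lambda1 tm GWt) cut_law_leaf.
  by rewrite /H markov_law1//; exact: split_law_subprob.
have [PS0|PS_neq0] := eqVneq (PS nu 1 m) 0%R.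
  apply: eq_esum => t tm; suff -> : GW nu t = 0%R by rewrite !mul0e.
  apply/eqP; rewrite eq_le GW_ge0// andbT -lee_fin -PS0 PS1E//.
  exact: (@le_esum_term _ _ [set u | lambda u = m] (fun t => (GW nu t)%:E)).
have PS_gt0 : (0 < PS nu 1 m)%R by rewrite lt_neqAle eq_sym PS_neq0 PS_ge0.
rewrite esumZr// -PS1E//= -/canon.
rewrite /H markov_law_Node; last 2 first.
- exact: split_law_subprob.
- by rewrite /bar; lia.
set zs := map canon ss.
rewrite esum_split_law// => [|p]; last first.
  by apply: esum_ge0 => ys _; exact: prodE_ge0.
under [in RHS]eq_esum do rewrite esum_markov_ranked_blocks mulrC EFinM -muleA.
rewrite esumZl => [||us]; last 2 first.
- by rewrite lee_fin invr_ge0 ltW.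
- by rewrite mule_ge0 ?lee_fin ?split_mass_ge0//; apply: esum_ge0 => ys _; exact: prodE_ge0.
rewrite muleA -EFinM divff// mul1e.
(* The induction hypothesis exchanges the two kernels; on trees with [j] leaves, [bar (lambda u)] is
   the constant [bar j]. *)
rewrite -(eq_esum_split_mass m (K := cut_law))//; last 2 first.
- by move=> *; exact: cut_law_ge0.
- move=> y /mapP[s sss ->] j; rewrite IH//.
  by apply: eq_esum => u /= ->.
rewrite -split_mass_identity//; last 2 first.
- by move=> us; apply: esum_ge0 => ys _; apply: prodE_ge0 => *; exact: cut_law_ge0.
- move=> us i; apply: esum_prodE_perm; last by rewrite perm_rot.
    by move=> *; exact: cut_law_ge0.
  move=> ys ys' p; rewrite /unpadded /= (perm_size p); apply: perm_trans.
  by rewrite perm_cat2r perm_sym.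
apply: eq_esum => t /= tm; rewrite cut_law_Node ?tm//.
by apply/eqP => t0; move: tm m2; case: t t0 => ts /= ->; rewrite lambdaE => <-.
Qed.

End Recursion.

(** * The cut-tree of the conditioned Galton-Watson tree *)

Theorem proposition1p1 (R : realType) (nu : nat -> R) (n : nat)
    (nu_law : is_law nu) (nu1 : nu 1%N = 0) (nu0 : 0 < nu 0%N)
    (n_ge2 : (2 <= n)%N) (n_pos : 0 < Pr (GW nu) [set t | lambda t = n]) :
  exists q : nat -> seq nat -> R,
    [/\ splitting_probabilities
          [set bar m | m in [set m | (1 <= m)%N /\ 0 < PS nu 1 m]] q,
        forall m k : nat, (2 <= m)%N -> 0 < PS nu 1 m -> (2 <= k)%N ->
          Pr (q (bar m)) [set p | size p = bar k] =
          (k%:R - 1) / (k%:R + 1) * nu k * ((m%:R + 1) / (m%:R - 1))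
            * (PS nu k.+1 m.+1 / (nu 0%N * PS nu 1 m)),
        forall m k : nat, (2 <= m)%N -> 0 < PS nu 1 m -> (2 <= k)%N ->
          0 < Pr (q (bar m)) [set p | size p = bar k] ->
          cond (q (bar m)) [set p | size p = bar k] =1 block_sizes nu m k
      & eq_law_nonplanar (mix (GWn nu n) cut_HW) (markov_branching q (bar n))].
Proof.
have PSn : 0 < PS nu 1 n by rewrite PS1_Pr.
exists (split_law nu); split.
- exact: split_law_splitting_probabilities.
- by move=> m k m2 PSm k2; rewrite Pr_split_law_size.
- by move=> m k m2 PSm k2; exact: cond_split_law_size.
move=> s; rewrite /Pr; congr fine.
have iso_canon : [set t | tree_iso t s] = [set t | canon t = canon s].
  by apply/seteqP; split=> t /=; rewrite tree_iso_canon => /eqP.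
rewrite iso_canon -/(markov_law (split_law nu) (bar n) (canon s)).
have GWn_ge0 t : 0 <= GWn nu n t.
  by rewrite /GWn /cond -PS1_Pr// divr_ge0 ?mulr_ge0 ?GW_ge0 ?PS_ge0.
have GWnE (f : tree -> \bar R) : (forall t, 0 <= f t)%E ->
    (\esum_(t in [set: tree]) ((GWn nu n t)%:E * f t) =
     (PS nu 1 n)^-1%:E *
     \esum_(t in [set t | lambda t = n]) ((GW nu t)%:E * f t))%E.
  move=> f0; rewrite -esumZl ?lee_fin ?invr_ge0 ?PS_ge0// => [|t]; last first.
    by rewrite mule_ge0// lee_fin GW_ge0.
  rewrite [RHS]esum_mkcond; apply: eq_esum => t _.
  rewrite /GWn /cond -PS1_Pr// indicE; case: (t \in _).
    by rewrite mul1r mulrC EFinM muleA.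
  by rewrite !mul0r mul0e.
have GWn_le1 : (\esum_(t in [set: tree]) (GWn nu n t)%:E <= 1)%E.
  have := GWnE (fun=> 1%E) (fun=> lee01).
  under eq_esum do rewrite mule1; move=> ->.
  under eq_esum do rewrite mule1.
  by rewrite -PS1E// -EFinM mulVf// lt0r_neq0.
under eq_esum => t' _.
  rewrite /mix meanE//; last by move=> t; exact: cut_HW_ge0_le1.
  over.
rewrite exchange_esum => [|t' t]; last first.
  by rewrite mule_ge0// lee_fin//; case/andP: (@cut_HW_ge0_le1 R t t').
(* The image by [add_singletons] followed by passage to canonical forms is [cut_law]. *)
transitivity (\esum_(t in [set: tree]) ((GWn nu n t)%:E * cut_law t (canon s)))%E.
  apply: eq_esum => t _; rewrite esumZl ?lee_fin// => [|t']; last first.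
    by rewrite lee_fin; case/andP: (@cut_HW_ge0_le1 R t t').
  congr (_ * _)%E; under eq_esum do rewrite cut_HWE.
  rewrite /cut_law (esum_preimage [set t' | canon t' = canon s] add_singletons)//.
  by move=> u; rewrite lee_fin cut_circ_ge0.
rewrite GWnE => [|t]; last exact: cut_law_ge0.
rewrite (cut_law_markov_law nu_law nu0 nu1) esumZr => [||t]; last 2 first.
- by apply: markov_law_ge0; exact: split_law_subprob.
- by rewrite lee_fin GW_ge0.
by rewrite -PS1E// muleA -EFinM mulVf ?mul1e// lt0r_neq0.
Qed.
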